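(* There exist absolute constants $c_1, c_2 > 0$ such that the following holds. Let $a \ge 8$ be an integer, let $K_a = \mathbb{Q}(\rho)$ be the simplest cubic field, where $\rho$ is the largest root of $f_a(X) = X^3 - aX^2 - (a+3)X - 1$, and assume that $\mathcal{O}_{K_a} = \mathbb{Z}[\rho]$. Then for every real $x \ge 1$, \[ c_1\left(\frac{(\log a)^2 x}{a^2} + \left(\frac{x}{a}\right)^{2/3} + x^{1/3}\right) \le P(a,x) \le c_2\left(\frac{(\log a)^2 x}{a^2} + \left(\frac{x}{a}\right)^{2/3} + x^{1/3}\right) \] and \[ c_1\left(\frac{(\log a)^2 x}{a^2} + \left(\frac{x}{a}\right)^{2/3} + 1\right) \le P_p(a,x) \le c_2\left(\frac{(\log a)^2 x}{a^2} + \left(\frac{x}{a}\right)^{2/3} + 1\right). \]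
   Context: For an integer $a \ge -1$, $K_a$ denotes the splitting field over $\mathbb{Q}$ of $f_a(X) = X^3 - aX^2 - (a+3)X - 1$; it is a totally real cyclic cubic field (a ''simplest cubic field'') and $K_a = \mathbb{Q}(\rho)$ with $\rho$ the largest real root of $f_a$. $\mathcal{O}_{K_a}$ is its ring of integers. $P(a,x)$ is the number of nonzero principal ideals $I \subset \mathcal{O}_{K_a}$ with norm $\mathrm{N}(I) = [\mathcal{O}_{K_a} : I] \le x$. An ideal $I \subset \mathcal{O}_{K_a}$ is primitive if $n \nmid I$ for every integer $n \ge 2$ (that is, $I \not\subset n\mathcal{O}_{K_a}$). $P_p(a,x)$ is the number of nonzero primitive principal ideals $I \subset \mathcal{O}_{K_a}$ with $\mathrm{N}(I) \le x$. *)

(* Defs.v *)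
From mathcomp Require Import all_boot all_order all_algebra.
From mathcomp Require Import all_classical all_reals all_analysis.
Set Implicit Arguments.
Unset Strict Implicit.
Unset Printing Implicit Defensive.
Import Order.TTheory GRing.Theory Num.Theory.
Import numFieldNormedType.Exports.
Local Open Scope classical_set_scope.
Local Open Scope ring_scope.

(* Number fields, their orders and the ideals of these are subsets of the
   real line: Q(r) is [adjoin_rat r] and Z[r] is [adjoin_int r]. *)

Definition simplest_cubic (a : int) : {poly int} :=
  'X^3 - a%:P * 'X^2 - (a + 3)%:P * 'X - 1.

Definition is_largest_root (R : realType) (p : {poly int}) (r : R) : Prop :=
  root (map_poly intr p) r /\
  forall s : R, root (map_poly intr p) s -> s <= r.

Definition adjoin_rat (R : realType) (r : R) : set R :=
  [set z | exists p q : {poly rat},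
     (map_poly ratr q).[r] != 0 /\
     z = (map_poly ratr p).[r] / (map_poly ratr q).[r]].

Definition adjoin_int (R : realType) (r : R) : set R :=
  [set z | exists p : {poly int}, z = (map_poly intr p).[r]].

Definition ring_of_integers (R : realType) (K : set R) : set R :=
  [set z | K z /\ integralOver (intr : int -> R) z].

Definition multiples (R : realType) (O : set R) (z : R) : set R :=
  [set z * y | y in O].

Definition nonzero_principal_ideal (R : realType) (O I : set R) : Prop :=
  I <> [set 0] /\ exists2 z : R, O z & I = multiples O z.

Definition primitive_ideal (R : realType) (O I : set R) : Prop :=
  forall n : nat, (2 <= n)%N -> ~ (I `<=` multiples O n%:R).

(* [counting] is the cardinality of a set, +oo when the set is infinite;
   thus [ideal_norm O I] is the index [O : I] of additive groups. *)
Definition cosets (R : realType) (O I : set R) : set (set R) :=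
  [set [set z + y | y in I] | z in O].

Definition ideal_norm (R : realType) (O I : set R) : \bar R :=
  counting (cosets O I).

Definition nb_principal (R : realType) (O : set R) (x : R) : \bar R :=
  counting [set I : set R |
    nonzero_principal_ideal O I /\ (ideal_norm O I <= x%:E)%E].

Definition nb_primitive_principal (R : realType) (O : set R) (x : R) : \bar R :=
  counting [set I : set R |
    [/\ nonzero_principal_ideal O I, primitive_ideal O I &
        (ideal_norm O I <= x%:E)%E]].

(* Main.v *)
(* Write rho, rho', rho'' for the roots of the cubic, close to a + 1, -1 and 0;
   then 1, rho, rho' is a basis of Z[rho] and N(p + q rho + r rho') is explicit.

   Upper bound. A generator minimising the trace of its square cannot be
   improved by a unit +-rho^i rho'^j, so its conjugates w1, w2, w3 differ by
   factors at most 2a.  After a cyclic permutation |w2| is the least one, and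
   then |q|, |r| <= 3 |w2|, a |q| <= 7 |w1| and a |r| <= 7 |w3|.  Counting the
   possible p for given q and r gives (log a)^2 x / a^2 for q r <> 0,
   (x/a)^(2/3) if exactly one of q, r vanishes, and the ideals pO otherwise.

   Lower bound. An element of Z[rho] outside Z has two conjugates more than a
   apart; so totally positive elements whose corresponding conjugates have
   ratios in [1/a, a] generate distinct ideals.  No knowledge of the unit group
   is needed.  The elements p + q (rho + 2) + r (rho' + 2) with p, q, r in
   suitable boxes provide enough of them, and gcd(q, r) = 1 makes them
   primitive. *)
Require Import Defs.
From mathcomp Require Import all_boot all_order all_algebra.
From mathcomp Require Import all_classical all_reals all_analysis.
From mathcomp Require Import finmap zify ring lra.
Import Order.TTheory GRing.Theory Num.Theory.
Import numFieldNormedType.Exports.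
Local Open Scope ring_scope.

(** * Coordinates with respect to 1, rho, rho' *)

(** The factor (log a)^2 counts scales. The norm of p + q rho + r rho' has order a^2 p q r on the
    relevant range, and at a fixed norm q and r can be rescaled independently, over about log a
    scales each, before ratios of conjugates exceed a. The same two logarithms arise in the upper
    bound as sums of 1/(X/a^2 + k) over k = |q| and k = |r| up to 3X, where X = x^(1/3).

    The obstacle is to match every term with constants independent of a and x. When x is too small
    for a single box of the logarithmic family, (x/a)^(1/3) is at most of order a^(2/3); the
    logarithmic term is then dominated by (x/a)^(2/3), because (log a)^2 is O(a^(1/3)). The term
    x^(1/3) is the number of ideals nO of norm n^3 <= x; among these only O itself is primitive,
    which is why it becomes 1 in the second estimate. *)

Notation triple := (int * int * int)%type.

(* With r1, r2, r3 cyclically conjugate, the conjugates of p + q r1 + r r2 are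
   ev r1 r2, ev r2 r3 and ev r3 r1 of (p, q, r). *)
Definition ev (R : realType) (r s : R) (t : triple) : R :=
  t.1.1%:~R + t.1.2%:~R * r + t.2%:~R * s.
Arguments ev {R}.

Definition tmul (a : int) (t u : triple) : triple :=
  let: (p, q, r) := t in let: (p', q', r') := u in
  (p * p' + (a + 2) * q * q' - (q * r' + r * q') + 2 * r * r',
   p * q' + q * p' + a * q * q' - (q * r' + r * q') + r * r',
   p * r' + r * p' - q * q' + (a + 1) * r * r').

(** A generator of the Galois group in coordinates: r3 = a - r1 - r2 is substituted in p + q r2 + r
    r3. *)
Definition tconj (a : int) (t : triple) : triple :=
  let: (p, q, r) := t in (p + r * a, - r, q - r).

(* The determinant of multiplication by t in the basis 1, rho, rho'. *)
Definition tnorm (a : int) (t : triple) : int :=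
  let: (p, q, r) := t in
  p * ((p + a * q - r) * (p + (a + 1) * r) + q * (r - q))
  - q * (((a + 2) * q - r) * (p + (a + 1) * r) + q * (2 * r - q))
  + r * (((a + 2) * q - r) * (r - q) - (p + a * q - r) * (2 * r - q)).

Definition ttrace (a : int) (t : triple) : int :=
  let: (p, q, r) := t in 3 * p + (q + r) * a.

(** The multiplication table of the basis 1, r, s. It holds for each of the pairs (r1, r2), (r2,
    r3), (r3, r1), so that [ev_mul] serves all three embeddings. *)
Definition consecutive_roots (R : realType) (A r s : R) : Prop :=
  [/\ r ^+ 2 = A + 2 + A * r - s, r * s = - 1 - r
    & s ^+ 2 = 2 + r + (A + 1) * s].
Arguments consecutive_roots {R}.

Lemma ev_mul (R : realType) (a : int) (r s : R) (t u : triple) :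
  consecutive_roots a%:~R r s -> ev r s (tmul a t u) = ev r s t * ev r s u.
Proof.
case: t u => [[p q] w] [[p' q'] w'] [h1 h2 h3]; rewrite /ev /=.
rewrite !(rmorphD, rmorphM, rmorphN, rmorphB, rmorph1) /=.
have e2 : (2 : int)%:~R = 2 :> R by [].
set P := p%:~R; set Q := q%:~R; set W := w%:~R.
set P' := p'%:~R; set Q' := q'%:~R; set W' := w'%:~R.
have -> : (P + Q * r + W * s) * (P' + Q' * r + W' * s) =
  P * P' + (P * Q' + Q * P') * r + (P * W' + W * P') * s + Q * Q' * r ^+ 2
  + (Q * W' + W * Q') * (r * s) + W * W' * s ^+ 2 by ring.
rewrite h1 h2 h3; ring.
Qed.

(** The product of the three conjugates is rational already as a polynomial identity over the
    integers; no root of the cubic is involved. *)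
Lemma tmul_conj_norm (a : int) (t : triple) :
  tmul a t (tmul a (tconj a t) (tconj a (tconj a t))) = (tnorm a t, 0, 0).
Proof. by case: t => [[p q] r] /=; congr (_, _, _); ring. Qed.

(* The cubic is irreducible mod 2; descent on powers of 2 then shows that the
   norm form is anisotropic over Z. *)
Lemma tnorm_even (a : int) (t : triple) : (2 %| tnorm a t)%Z ->
  exists u : triple, t = (2 * u.1.1, 2 * u.1.2, 2 * u.2).
Proof.
case: t => [[p q] r].
have F2 : 2%N \in [pchar 'F_2] by exact: pchar_Fp.
have dvd2 (z : int) : (2 %| z)%Z = (z%:~R == 0 :> 'F_2).
  exact: (dvdz_pcharf F2).
rewrite dvd2 /tnorm !(rmorphD, rmorphM, rmorphN, rmorphB) /= => h.
suff [/dvdzP[p' ->] /dvdzP[q' ->] /dvdzP[r' ->]] :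
    [/\ (2 %| p)%Z, (2 %| q)%Z & (2 %| r)%Z].
  by exists (p', q', r') => /=; congr (_, _, _); exact: mulrC.
move: h; rewrite !dvd2.
move: (a%:~R : 'F_2) (p%:~R : 'F_2) (q%:~R : 'F_2) (r%:~R : 'F_2).
by case=> [[|[|//]] ?] [[|[|//]] ?] [[|[|//]] ?] [[|[|//]] ?].
Qed.

(** This yields the linear independence of 1, rho, rho' over the integers, hence [ev_inj]. In the
    descent, homogeneity of degree 3 gives the factor 8. *)
Lemma tnorm_eq0 (a : int) (t : triple) : tnorm a t = 0 -> t = (0, 0, 0).
Proof.
have [n] := ubnP (absz t.1.1 + absz t.1.2 + absz t.2)%N.
elim: n t => // n IHn t tn t0.
have /tnorm_even[u tu] : (2 %| tnorm a t)%Z by rewrite t0.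
suff u0 : u = (0, 0, 0) by rewrite tu u0 /= !mulr0.
have [-> //|u_neq0] := eqVneq u (0, 0, 0).
apply: IHn.
  have : (absz u.1.1 + absz u.1.2 + absz u.2 != 0)%N.
    by apply: contra u_neq0; case: (u) => [[x y] z] /=; rewrite !xpair_eqE; lia.
  by rewrite tu /= in tn; lia.
have : 8 * tnorm a u = 0.
  by rewrite -t0 tu; case: (u) => [[x y] z] /=; ring.
by move/eqP; rewrite mulf_eq0 /= => /eqP.
Qed.

(** * Location of the roots *)

Lemma horner_simplest_cubic (R : realType) (a : int) (x : R) :
  (map_poly intr (simplest_cubic a)).[x] =
  x ^+ 3 - a%:~R * x ^+ 2 - (a%:~R + 3) * x - 1.
Proof.
rewrite /simplest_cubic !rmorphB /= map_polyXn rmorphM /= map_polyXn.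
rewrite rmorphM /= map_polyX !map_polyC /=.
by rewrite rmorph1 rmorphD !(hornerD, hornerN, hornerM, hornerXn, hornerX, hornerC).
Qed.

Lemma cubic_root_lt (R : realType) (A x : R) : 8 <= A ->
  x ^+ 3 = A * x ^+ 2 + (A + 3) * x + 1 -> x < A + 2.
Proof.
move=> A8 e; rewrite ltNge; apply/negP => h.
have h1 : 2 * x <= x * (x - A) by nra.
have h2 : x * (2 * x - (A + 3)) <= x * (x * (x - A) - (A + 3)).
  by rewrite ler_wpM2l //; lra.
have h3 : x * (x * (x - A) - (A + 3)) = x ^+ 3 - A * x ^+ 2 - (A + 3) * x.
  by ring.
by rewrite h3 e in h2; nra.
Qed.

Lemma largest_root_eq (R : realType) (a : int) (rho : R) :
  is_largest_root (simplest_cubic a) rho ->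
  rho ^+ 3 = a%:~R * rho ^+ 2 + (a%:~R + 3) * rho + 1.
Proof. by move=> [/rootP + _]; rewrite horner_simplest_cubic => h; lra. Qed.

(** The cubic equals -2a - 3 at a + 1 and a^2 + 3a + 1 at a + 2, so it has a root in between; as the
    first value is not 0, the inequality is strict. *)
Lemma largest_root_gt (R : realType) (a : int) (rho : R) : 8 <= a ->
  is_largest_root (simplest_cubic a) rho -> a%:~R + 1 < rho.
Proof.
move=> a8 rho_root; have := largest_root_eq _ _ _ rho_root.
have [_ rho_max] := rho_root.
have A8 : 8 <= a%:~R :> R by move: a8; rewrite -(ler_int R).
have f1 : (map_poly intr (simplest_cubic a)).[a%:~R + 1 : R] <= 0.
  by rewrite horner_simplest_cubic; move: A8; move: (_%:~R) => A A8; nra.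
have f2 : 0 <= (map_poly intr (simplest_cubic a)).[a%:~R + 2 : R].
  by rewrite horner_simplest_cubic; move: A8; move: (_%:~R) => A A8; nra.
have lt12 : a%:~R + 1 <= a%:~R + 2 :> R by rewrite lerD2l; lra.
have [x /andP[x1 x2] xf] := poly_ivt lt12 (introT andP (conj f1 f2)).
have le_x_rho := rho_max x xf.
move: A8 x1; move: (_%:~R) => A A8 x1 e.
rewrite lt_neqAle (le_trans x1 le_x_rho) andbT; apply/eqP => e'.
by move: e; rewrite -e'; nra.
Qed.

Record conjugate_roots (R : realType) (A r1 r2 r3 : R) : Prop := ConjugateRoots {
  conj_ge8 : 8 <= A;
  conj_sum : r1 + r2 + r3 = A;
  conj_12 : consecutive_roots A r1 r2;
  conj_23 : consecutive_roots A r2 r3;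
  conj_31 : consecutive_roots A r3 r1;
  conj_gt1 : A + 1 < r1;
  conj_lt1 : r1 < A + 2;
  conj_gt2 : - (10 / 9) < r2;
  conj_lt2 : r2 < -1;
  conj_gt3 : - (1 / 10) < r3;
  conj_lt3 : r3 < 0;
  conj_gt32 : 1 < r3 - r2;
  conj_lt32 : r3 - r2 < 1 + 1 / 90;
  (* r1 - r3 > A + (r3 - r2): with r1 - r2 > A + 2 it makes the spread of an
     element outside Z exceed A *)
  conj_gt132 : A + 1 < r1 - r3 - (r3 - r2 - 1) }.
Arguments conjugate_roots {R}.
Arguments conj_12 {R A r1 r2 r3}.
Arguments conj_ge8 {R A r1 r2 r3}.
Arguments conj_sum {R A r1 r2 r3}.

(** The map x -> -1 - 1/x has order 3 and permutes the roots cyclically. The cubic makes 1/x and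
    1/(1 + x) polynomials in x, which reduces the quadratic relations among the roots to linear
    arithmetic. *)
Lemma conjugate_roots_of_eq (R : realType) (A x : R) : 8 <= A -> A + 1 < x ->
  x ^+ 3 = A * x ^+ 2 + (A + 3) * x + 1 ->
  conjugate_roots A x (- 1 - x^-1) (- (1 + x)^-1).
Proof.
move=> A8 gt1 e; have lt1 := cubic_root_lt _ _ _ A8 e.
have x0 : x != 0 by lra.
have x10 : 1 + x != 0 by lra.
have i0 : 0 < x^-1 by rewrite invr_gt0; lra.
have eV : x * x^-1 = 1 by rewrite divff.
have j0 : 0 < (1 + x)^-1 by rewrite invr_gt0; lra.
have fV : (1 + x) * (1 + x)^-1 = 1 by rewrite divff.
have k0 : 0 < x^-1 - (1 + x)^-1.
  have -> : x^-1 - (1 + x)^-1 = x^-1 * (1 + x)^-1.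
    by field; rewrite x0 x10.
  exact: mulr_gt0.
have eW : x^-1 = x ^+ 2 - A * x - (A + 3).
  apply: (mulfI x0); rewrite eV.
  have -> : x * (x ^+ 2 - A * x - (A + 3)) =
            x ^+ 3 - A * x ^+ 2 - (A + 3) * x by ring.
  by rewrite e; ring.
have fW : (1 + x)^-1 = - x ^+ 2 + (A + 1) * x + 2.
  apply: (mulfI x10); rewrite fV.
  have -> : (1 + x) * (- x ^+ 2 + (A + 1) * x + 2) =
            - x ^+ 3 + A * x ^+ 2 + (A + 3) * x + 2 by ring.
  by rewrite e; ring.
have ij : x^-1 - (1 + x)^-1 = x^-1 * (1 + x)^-1.
  by field; rewrite x0 x10.
have bnd1 : x^-1 < 1 / 9 by nra.
have bnd2 : (1 + x)^-1 < 1 / 10 by nra.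
move: (x^-1) ((1 + x)^-1) i0 j0 eV fV k0 ij eW fW bnd1 bnd2 => i j.
move=> i0 j0 xi xj k0 ij iE jE bnd1 bnd2.
have ii : i * i = x - A - (A + 3) * i.
  by rewrite {1}iE !mulrBl expr2 -!mulrA xi; ring.
have jx : x * j = 1 - j by lra.
have jj : j * j = - x + 1 - j + (A + 1) - (A + 1) * j + 2 * j.
  have -> : j * j = - (x * (x * j)) + (A + 1) * (x * j) + 2 * j.
    by rewrite {1}jE; ring.
  by rewrite jx mulrBr jx; ring.
by split=> //; try (split; lra); try lra; nra.
Qed.

(** * Arithmetic and principal ideals of Z[rho] *)

Lemma evB (R : realType) (r s : R) (t u : triple) :
  ev r s (t - u) = ev r s t - ev r s u.
Proof.
by case: t u => [[p q] w] [[p' q'] w']; rewrite /ev /= !intrB; ring.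
Qed.

Lemma int_trichotomy (z : int) : (z <= -1) || (z == 0) || (1 <= z).
Proof. lia. Qed.

Lemma evD (R : realType) (r s : R) (t u : triple) :
  ev r s (t + u) = ev r s t + ev r s u.
Proof.
by case: t u => [[p q] w] [[p' q'] w']; rewrite /ev /= !intrD; ring.
Qed.

Lemma ev_int (R : realType) (r s : R) (p : int) : ev r s (p, 0, 0) = p%:~R.
Proof. by rewrite /ev /= !mul0r !addr0. Qed.

Lemma ev_tconj (R : realType) (a : int) (r s w : R) (t : triple) :
  r + s + w = a%:~R -> ev r s (tconj a t) = ev s w t.
Proof.
by case: t => [[p q] k] e; rewrite /ev /= intrD intrM -e intrN intrB; ring.
Qed.

Section order_arithmetic.
Variables (R : realType) (a : int) (r1 r2 r3 : R).
Hypothesis roots : conjugate_roots a%:~R r1 r2 r3.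

Lemma ev_tconj12 (t : triple) : ev r1 r2 (tconj a t) = ev r2 r3 t.
Proof. apply: ev_tconj; exact: conj_sum roots. Qed.

Lemma ev_tconj23 (t : triple) : ev r2 r3 (tconj a t) = ev r3 r1 t.
Proof. by apply: ev_tconj; have := conj_sum roots; lra. Qed.

Lemma ev_tconj31 (t : triple) : ev r3 r1 (tconj a t) = ev r1 r2 t.
Proof. by apply: ev_tconj; have := conj_sum roots; lra. Qed.

Lemma ev_tmul12 (t u : triple) :
  ev r1 r2 (tmul a t u) = ev r1 r2 t * ev r1 r2 u.
Proof. apply: ev_mul; exact: conj_12 roots. Qed.

Lemma ev_tmul23 (t u : triple) :
  ev r2 r3 (tmul a t u) = ev r2 r3 t * ev r2 r3 u.
Proof. apply: ev_mul; exact: conj_23 roots. Qed.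

Lemma ev_tmul31 (t u : triple) :
  ev r3 r1 (tmul a t u) = ev r3 r1 t * ev r3 r1 u.
Proof. apply: ev_mul; exact: conj_31 roots. Qed.

Lemma ev_tnorm (t : triple) :
  (tnorm a t)%:~R = ev r1 r2 t * ev r2 r3 t * ev r3 r1 t.
Proof.
rewrite -(ev_int R r1 r2) -tmul_conj_norm !ev_tmul12 !ev_tconj12 ev_tconj23.
by rewrite mulrA.
Qed.

Lemma ev_eq0 (t : triple) : ev r1 r2 t = 0 -> t = (0, 0, 0).
Proof.
move=> e; apply: (tnorm_eq0 a); apply/eqP; rewrite -(intr_eq0 R) ev_tnorm e.
by rewrite !mul0r.
Qed.

Lemma ev_inj : injective (ev r1 r2).
Proof.
move=> t u e; apply/eqP; rewrite -subr_eq0; apply/eqP.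
by apply: ev_eq0; rewrite evB e subrr.
Qed.

Lemma tnorm_neq0 (t : triple) : t != (0, 0, 0) -> tnorm a t != 0.
Proof. by apply: contra_neq; exact: tnorm_eq0. Qed.

Lemma ev_neq0 (t : triple) : t != (0, 0, 0) ->
  [/\ ev r1 r2 t != 0, ev r2 r3 t != 0 & ev r3 r1 t != 0].
Proof.
move=> /tnorm_neq0; rewrite -(intr_eq0 R) ev_tnorm !mulf_eq0 !negb_or.
by move=> /andP[/andP[-> ->] ->].
Qed.

Lemma adjoin_intE : adjoin_int r1 = range (ev r1 r2).
Proof.
apply/seteqP; split=> [_ [p ->]|_ [[[p q] w] _ <-]].
  elim/poly_ind: p => [|p c [t _ ht]].
    by exists (0, 0, 0) => //; rewrite rmorph0 horner0 ev_int.
  exists (tmul a t (0, 1, 0) + (c, 0, 0)) => //.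
  rewrite rmorphD rmorphM /= map_polyX map_polyC hornerD hornerM hornerX.
  rewrite hornerC -ht evD ev_int ev_tmul12; congr (_ * _ + _).
  by rewrite /ev /= mul1r mul0r add0r addr0.
have [h _ _] := conj_12 roots.
(* The factor of w is rho' as a polynomial in rho, read off from the relation for rho^2. *)
exists (p%:P + q%:P * 'X + w%:P * ((a + 2)%:P + a%:P * 'X - 'X^2)).
have poly_eq : map_poly intr (p%:P + q%:P * 'X
      + w%:P * ((a + 2)%:P + a%:P * 'X - 'X^2)) =
    (p%:~R)%:P + (q%:~R)%:P * 'X
      + (w%:~R)%:P * ((a%:~R + 2)%:P + (a%:~R)%:P * 'X - 'X^2) :> {poly R}.
  rewrite 2!rmorphD /= map_polyC rmorphM /= map_polyC map_polyX.
  rewrite rmorphM /= map_polyC rmorphB /= map_polyXn rmorphD /= map_polyC.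
  by rewrite rmorphM /= map_polyC map_polyX rmorphD.
rewrite poly_eq !(hornerD, hornerN, hornerM, hornerXn, hornerX, hornerC).
have -> : r2 = a%:~R + 2 + a%:~R * r1 - r1 ^+ 2 by rewrite h; ring.
by rewrite /ev /=; ring.
Qed.

Lemma ev_multiples (t : triple) (y : R) :
  multiples (adjoin_int r1) (ev r1 r2 t) y <->
  exists u, y = ev r1 r2 (tmul a t u).
Proof.
rewrite adjoin_intE; split=> [[_ [u _ <-] <-]|[u ->]].
  by exists u; rewrite ev_tmul12.
by exists (ev r1 r2 u); [exists u|rewrite ev_tmul12].
Qed.

Lemma tmul1 (t : triple) : tmul a t (1, 0, 0) = t.
Proof. by apply: ev_inj; rewrite ev_tmul12 ev_int mulr1. Qed.

Lemma tmulA (t u v : triple) : tmul a t (tmul a u v) = tmul a (tmul a t u) v.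
Proof. by apply: ev_inj; rewrite !ev_tmul12 mulrA. Qed.

Lemma multiples_eq (t u : triple) :
  multiples (adjoin_int r1) (ev r1 r2 t) =
  multiples (adjoin_int r1) (ev r1 r2 u) ->
  (exists v, t = tmul a u v) /\ (exists v, u = tmul a t v).
Proof.
move=> e; split.
  have : multiples (adjoin_int r1) (ev r1 r2 t) (ev r1 r2 t).
    by apply/ev_multiples; exists (1, 0, 0); rewrite tmul1.
  by rewrite e => /ev_multiples[v /ev_inj]; exists v.
have : multiples (adjoin_int r1) (ev r1 r2 u) (ev r1 r2 u).
  by apply/ev_multiples; exists (1, 0, 0); rewrite tmul1.
by rewrite -e => /ev_multiples[v /ev_inj]; exists v.
Qed.

Lemma multiples_unit (t u v : triple) : tmul a u v = (1, 0, 0) ->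
  multiples (adjoin_int r1) (ev r1 r2 (tmul a t u)) =
  multiples (adjoin_int r1) (ev r1 r2 t).
Proof.
move=> uv1; apply/seteqP; split=> y /ev_multiples[w ->]; apply/ev_multiples.
  by exists (tmul a u w); rewrite tmulA.
by exists (tmul a v w); rewrite !tmulA -(tmulA t) uv1 tmul1.
Qed.

Lemma nonzero_ideal_triple (I : set R) :
  nonzero_principal_ideal (adjoin_int r1) I <->
  exists2 t : triple, t != (0, 0, 0) & I = multiples (adjoin_int r1) (ev r1 r2 t).
Proof.
split=> [[I0 [z]]|[t t0 ->]].
  rewrite {1}adjoin_intE => -[t _ <-] IE; exists t => //; apply/eqP => t0.
  apply: I0; rewrite IE t0; apply/seteqP; split=> y.
    by rewrite ev_int => -[w _ <-] /=; rewrite mul0r.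
  move=> /= ->; apply/ev_multiples; exists (0, 0, 0).
  by rewrite ev_tmul12 ev_int mul0r.
split; last first.
  by exists (ev r1 r2 t) => //; rewrite adjoin_intE; exists t.
move=> e; have : multiples (adjoin_int r1) (ev r1 r2 t) (ev r1 r2 t).
  by apply/ev_multiples; exists (1, 0, 0); rewrite tmul1.
by rewrite e /= => /ev_eq0/eqP; exact/negP.
Qed.

(** The two differences are q (r1 - r2) - w (r3 - r2) and -(q (r3 - r2) + w (r1 - r3)), where r1 -
    r2 and r1 - r3 exceed a and r3 - r2 > 0. If q and w have opposite signs or w alone vanishes,
    nothing cancels in the first; if they have equal signs or q alone vanishes, nothing cancels in
    the second. So one of them exceeds a unless q = w = 0. *)
Lemma small_spread_int (t : triple) :
  `|ev r1 r2 t - ev r2 r3 t| < a%:~R ->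
  `|ev r2 r3 t - ev r3 r1 t| < a%:~R -> t = (t.1.1, 0, 0).
Proof.
case: t => [[p q] w] /=.
have [A8 _ _ _ _ g1 l1 g2 l2 g3 l3 g32 l32 g132] := roots.
rewrite /ev /= !ltr_norml; move: A8 g1 l1 g132; set A := a%:~R.
set Q := q%:~R; set W := w%:~R => A8 g1 l1 g132 /andP[h1 h2] /andP[h3 h4].
have int_gt0 := int_trichotomy.
have W1 : (w <= -1) = (W <= -1) by rewrite -(ler_int R) intrN.
have W2 : (1 <= w) = (1 <= W) by rewrite -(ler_int R).
have Q1 : (q <= -1) = (Q <= -1) by rewrite -(ler_int R) intrN.
have Q2 : (1 <= q) = (1 <= Q) by rewrite -(ler_int R).
suff [Q0 W0] : Q = 0 /\ W = 0.
  have -> : q = 0 by apply/eqP; rewrite -(intr_eq0 R) -/Q Q0.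
  by have -> : w = 0 by apply/eqP; rewrite -(intr_eq0 R) -/W W0.
have e1 : p%:~R + Q * r1 + W * r2 - (p%:~R + Q * r2 + W * r3)
   = Q * (r1 - r2) - W * (r3 - r2) by ring.
have e2 : p%:~R + Q * r2 + W * r3 - (p%:~R + Q * r3 + W * r1)
   = - (Q * (r3 - r2)) - W * (r1 - r3) by ring.
rewrite {}e1 in h1 h2; rewrite {}e2 in h3 h4.
have d1 : A + 2 < r1 - r2 by lra.
have d2 : A + (r3 - r2) < r1 - r3 by lra.
move: (r1 - r2) (r3 - r2) (r1 - r3) d1 d2 h1 h2 h3 h4 g32 l32.
move=> x d y d1 d2 h1 h2 h3 h4 g32 l32.
have := int_gt0 w; rewrite -(intr_eq0 R) -/W W1 W2.
have := int_gt0 q; rewrite -(intr_eq0 R) -/Q Q1 Q2.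
move=> {int_gt0 W1 W2 Q1 Q2} /orP[/orP[q0|/eqP q0]|q0] /orP[/orP[w0|/eqP w0]|w0].
- by exfalso; nra.
- by exfalso; rewrite w0 in h1 h2; nra.
- by exfalso; nra.
- by exfalso; rewrite q0 in h3 h4; nra.
- by split.
- by exfalso; rewrite q0 in h3 h4; nra.
- by exfalso; nra.
- by exfalso; rewrite w0 in h1 h2; nra.
- by exfalso; nra.
Qed.

End order_arithmetic.
Arguments adjoin_intE {R a r1 r2 r3} roots.
Arguments ev_inj {R a r1 r2 r3} roots.
Arguments ev_multiples {R a r1 r2 r3} roots.
Arguments ev_neq0 {R a r1 r2 r3} roots.
Arguments ev_tconj12 {R a r1 r2 r3} roots.
Arguments ev_tconj23 {R a r1 r2 r3} roots.
Arguments ev_tconj31 {R a r1 r2 r3} roots.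
Arguments ev_tmul12 {R a r1 r2 r3} roots.
Arguments ev_tmul23 {R a r1 r2 r3} roots.
Arguments ev_tmul31 {R a r1 r2 r3} roots.
Arguments ev_tnorm {R a r1 r2 r3} roots.
Arguments multiples_eq {R a r1 r2 r3} roots.
Arguments multiples_unit {R a r1 r2 r3} roots.
Arguments nonzero_ideal_triple {R a r1 r2 r3} roots.
Arguments small_spread_int {R a r1 r2 r3} roots.
Arguments tmul1 {R a r1 r2 r3} roots.
Arguments tmulA {R a r1 r2 r3} roots.

(** * The index of a principal ideal *)

Lemma counting_le_size (R : realType) (U : eqType) (T : choiceType)
    (s : seq U) (f : U -> T) (S : set T) :
  (forall y, S y -> exists2 x, x \in s & y = f x) ->
  (counting S <= (size s)%:R%:E :> \bar R)%E.
Proof.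
move=> sS.
have finS : finite_set S.
  apply: (@sub_finite_set _ _ [set` [seq f x | x <- s]]) => //= y /sS[x xs ->].
  exact: map_f.
rewrite /counting asboolT // lee_fin ler_nat -(size_map f).
apply: uniq_leq_size; first exact: fset_uniq.
move=> y; rewrite in_fset_set // => /set_mem/sS[x xs ->]; exact: map_f.
Qed.

Lemma counting_ge_size (R : realType) (U : eqType) (T : choiceType)
    (s : seq U) (f : U -> T) (S : set T) :
  uniq s -> {in s &, injective f} -> (forall x, x \in s -> S (f x)) ->
  ((size s)%:R%:E <= counting S :> \bar R)%E.
Proof.
move=> us fI sS; rewrite /counting; case: asboolP => [finS|_]; last exact: leey.
rewrite lee_fin ler_nat -(size_map f).
apply: uniq_leq_size; first by rewrite map_inj_in_uniq.
by move=> y /mapP[x xs ->]; rewrite in_fset_set //; apply/mem_set/sS.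
Qed.

Lemma counting_eq_size (R : realType) (U : eqType) (T : choiceType)
    (s : seq U) (f : U -> T) (S : set T) :
  uniq s -> {in s &, injective f} -> (forall x, x \in s -> S (f x)) ->
  (forall y, S y -> exists2 x, x \in s & y = f x) ->
  counting S = (size s)%:R%:E :> \bar R.
Proof.
move=> us fI sS Ss; apply/le_anti/andP; split.
  exact: counting_le_size Ss.
exact: counting_ge_size us fI sS.
Qed.

Lemma subset_counting (R : realType) (T : choiceType) (S S' : set T) :
  (S `<=` S')%classic -> (counting S <= counting S' :> \bar R)%E.
Proof.
move=> sub; rewrite {2}/counting; case: asboolP => [finS'|_]; last exact: leey.
apply: (counting_le_size _ T T (enum_fset (fset_set S')) id) => y /sub ?.
by exists y => //; rewrite in_fset_set //; exact/mem_set.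
Qed.

(** By the Smith normal form M = L D Q with L, Q unimodular, the vectors f Q with 0 <= f_i < |d_i|
    represent the classes modulo the row lattice of M. The invariant factors may be negative, hence
    the absolute values. *)
Lemma row_lattice_transversal (n : nat) (M : 'M[int]_n) : \det M != 0 ->
  exists s : seq 'rV[int]_n,
  [/\ uniq s, size s = absz (\det M),
      forall v, exists2 w, w \in s & exists u, v - w = u *m M
    & {in s &, forall v w, (exists u, v - w = u *m M) -> v = w}].
Proof.
have [L uL [Q uQ [d _ MD]]] := int_Smith_normal_form M => detM.
have DE : \matrix_(i, j) (d`_i *+ (i == j :> nat)) =
    diag_mx (\row_(i < n) d`_i).
  by apply/matrixP => i j; rewrite !mxE.
set D := diag_mx _ in DE; rewrite DE in MD => {DE}.
have unit_absz (P : 'M[int]_n) : P \in unitmx -> absz (\det P) = 1%N.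
  rewrite unitmxE => /divrr/(congr1 absz); rewrite abszM => /eqP.
  by rewrite muln_eq1 => /andP[/eqP].
have absM : absz (\det M) = \prod_(i < n) absz d`_i.
  rewrite MD !det_mulmx !abszM (unit_absz L uL) (unit_absz Q uQ) mul1n muln1 det_diag.
  by rewrite (big_morph absz abszM (erefl _)); apply: eq_bigr => i _; rewrite mxE.
have d0 (i : 'I_n) : d`_i != 0.
  move: detM; rewrite -absz_eq0 absM; apply: contra => /eqP di.
  by rewrite (bigD1 i) //= di.
pose rep (f : {dffun forall i : 'I_n, 'I_(absz d`_i)}) : 'rV[int]_n :=
  (\row_i (f i : nat)%:Z) *m Q.
have rep_eq f g u : rep f - rep g = u *m M -> f = g.
  rewrite /rep MD -mulmxBl !mulmxA => /(congr1 (mulmx^~ (invmx Q))).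
  rewrite !mulmxK // => e; apply/ffunP => i; apply: val_inj => /=.
  have := congr1 (fun v : 'rV_n => v 0 i) e; rewrite mul_mx_diag.
  move: (u *m L) => U; rewrite !mxE; move: (U 0 i) => k.
  move: (ltn_ord (f i)) (ltn_ord (g i)); move: (f i : nat) (g i : nat) => x y.
  move: (d`_i) => z lx ly {}e.
  have [k0|k0] := eqVneq k 0; first by rewrite k0 in e; lia.
  have : (absz z <= absz (x%:Z - y%:Z))%N.
    by rewrite e abszM leq_pmull // absz_gt0.
  by lia.
exists [seq rep f | f : {dffun forall i : 'I_n, 'I_(absz d`_i)}]; split.
- rewrite map_inj_uniq ?enum_uniq // => f g e.
  by apply: (rep_eq f g 0); rewrite e subrr mul0mx.
- rewrite size_map -cardE card_dep_ffun absM foldrE big_map.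
  by rewrite big_enum /=; apply: eq_bigr => i _; rewrite card_ord.
- move=> v; have [w wE] : {w | w = v *m invmx Q} by exists (v *m invmx Q).
  pose c i : int := w 0 i; pose e i : int := d`_i.
  have lt_mod (i : 'I_n) : (absz (c i %% e i)%Z < absz (e i))%N.
    have := ltz_mod (c i) (d0 i); have := modz_ge0 (c i) (d0 i).
    by rewrite -/(e i); lia.
  pose f : {dffun forall i : 'I_n, 'I_(absz d`_i)} :=
    [ffun i => Ordinal (lt_mod i)].
  exists (rep f); first by rewrite map_f // mem_enum.
  exists ((\row_i (c i %/ e i)%Z) *m invmx L).
  rewrite MD !mulmxA mulmxKV // /rep -{1}(mulmxKV uQ v) -wE -mulmxBl.
  congr (_ *m _); apply/rowP => i; rewrite mul_mx_diag !mxE ffunE /=.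
  by rewrite gez0_abs ?modz_ge0 ?d0 // {1}(divz_eq (w 0 i) (e i)) addrK.
- by move=> v w /mapP[f _ ->] /mapP[g _ ->] [u /rep_eq ->].
Qed.

Section ideal_index.
Variables (R : realType) (a : int) (r1 r2 r3 : R).
Hypothesis roots : conjugate_roots a%:~R r1 r2 r3.

Definition row_of_triple (t : triple) : 'rV[int]_3 :=
  \row_i [:: t.1.1; t.1.2; t.2]`_i.

Definition triple_of_row (v : 'rV[int]_3) : triple :=
  (v 0 0, v 0 1, v 0 2%:R).

Lemma triple_of_rowK : cancel triple_of_row row_of_triple.
Proof.
move=> v; apply/rowP => -[[|[|[|//]]] i]; rewrite mxE /=; congr (v _ _);
  exact: val_inj.
Qed.

Lemma row_of_tripleK : cancel row_of_triple triple_of_row.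
Proof. by move=> [[p q] w]; rewrite /triple_of_row !mxE. Qed.

Definition mul_matrix (t : triple) : 'M[int]_3 :=
  \matrix_(i < 3) row_of_triple
    (tmul a t [:: (1, 0, 0); (0, 1, 0); (0, 0, 1) : triple]`_i).

Lemma row_of_tmul (t u : triple) :
  row_of_triple (tmul a t u) = row_of_triple u *m mul_matrix t.
Proof.
case: t u => [[p q] w] [[p' q'] w']; apply/rowP => j.
rewrite !mxE !big_ord_recl big_ord0 !mxE /=.
by case: j => [[|[|[|//]]] i] /=; ring.
Qed.

Lemma det_mul_matrix (t : triple) : \det (mul_matrix t) = tnorm a t.
Proof.
case: t => [[p q] w].
rewrite (expand_det_row _ 0) !big_ord_recl big_ord0 /cofactor.
rewrite !(expand_det_row _ 0) !big_ord_recl !big_ord0 /cofactor !det_mx11.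
rewrite !mxE /=; ring.
Qed.

(** In coordinates the ideal is the row lattice of [mul_matrix t], so a transversal of that lattice
    lists every coset exactly once. *)
Lemma ideal_norm_triple (t : triple) : t != (0, 0, 0) ->
  ideal_norm (adjoin_int r1) (multiples (adjoin_int r1) (ev r1 r2 t)) =
  (absz (tnorm a t))%:R%:E.
Proof.
move=> t0; set I := multiples _ _.
have [|s [us sE s_cover s_inj]] := row_lattice_transversal _ (mul_matrix t).
  by rewrite det_mul_matrix (tnorm_neq0 a t).
have I_iff v w : (exists u, v - w = u *m mul_matrix t) <->
    I (ev r1 r2 (triple_of_row v) - ev r1 r2 (triple_of_row w)).
  split=> [[u e]|].
    apply/(ev_multiples roots); exists (triple_of_row u).
    rewrite -evB; congr ev; apply: (can_inj row_of_tripleK).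
    rewrite row_of_tmul triple_of_rowK -e.
    by apply/rowP => -[[|[|[|//]]] i]; rewrite !mxE /=; congr (v _ _ - w _ _);
      exact: val_inj.
  move=> /(ev_multiples roots)[u]; rewrite -evB.
  move=> /(ev_inj roots)/(congr1 row_of_triple).
  rewrite row_of_tmul => e; exists (row_of_triple u); rewrite -e.
  by apply/rowP => -[[|[|[|//]]] i]; rewrite !mxE /=; congr (v _ _ - w _ _);
    exact: val_inj.
pose f v : set R := [set ev r1 r2 (triple_of_row v) + y | y in I]%classic.
have I0 : I 0.
  apply/(ev_multiples roots); exists (0, 0, 0).
  by rewrite (ev_tmul12 roots) ev_int mulr0.
have ID y z : I y -> I z -> I (y + z).
  move=> /(ev_multiples roots)[u ->].
  move=> /(ev_multiples roots)[u' ->].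
  apply/(ev_multiples roots); exists (u + u').
  by rewrite !(ev_tmul12 roots) evD; ring.
have IN y : I y -> I (- y).
  move=> /(ev_multiples roots)[u ->].
  apply/(ev_multiples roots); exists ((0, 0, 0) - u).
  by rewrite !(ev_tmul12 roots) evB ev_int sub0r mulrN.
rewrite -det_mul_matrix -sE; apply: (counting_eq_size _ _ _ s f) => //.
- move=> v w vs ws fvw; apply: s_inj => //; apply/I_iff.
  have : f v (ev r1 r2 (triple_of_row v)) by exists 0 => //; rewrite addr0.
  by rewrite fvw => -[y Iy <-]; rewrite addrC addKr.
- move=> v _; exists (ev r1 r2 (triple_of_row v)) => //.
  by rewrite (adjoin_intE roots); exists (triple_of_row v).
- move=> y [z]; rewrite (adjoin_intE roots) => -[u _ <-] <- {y}.
  have [w ws /I_iff] := s_cover (row_of_triple u).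
  rewrite row_of_tripleK => Iuw; exists w => //; apply/seteqP; split=> _ [y Iy <-].
    exists (ev r1 r2 u - ev r1 r2 (triple_of_row w) + y); first exact: ID.
    by ring.
  exists (y - (ev r1 r2 u - ev r1 r2 (triple_of_row w))); last by ring.
  by apply: ID => //; exact: IN.
Qed.

End ideal_index.
Arguments ideal_norm_triple {R a r1 r2 r3} roots.

(** * Families of totally positive elements *)

Notation natriple := (nat * nat * nat)%type.

(* The triple of p + q (r1 + 2) + r (r2 + 2): the conjugates of r1 + 2 are all
   positive, so these elements are totally positive. *)
Definition shifted (t : natriple) : triple :=
  (t.1.1%:Z + 2 * t.1.2%:Z + 2 * t.2%:Z, t.1.2%:Z, t.2%:Z).

Lemma shifted_inj : injective shifted.
Proof. by move=> [[p q] w] [[p' q'] w'] [e1 e2 e3]; congr (_, _, _); lia. Qed.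

Lemma ev_shifted (R : realType) (r s : R) (t : natriple) :
  ev r s (shifted t) =
  t.1.1%:R + t.1.2%:R * (r + 2) + t.2%:R * (s + 2).
Proof. by rewrite /ev /shifted /= !intrD !intrM -!pmulrn; ring. Qed.

Lemma pos_factor_of_1 (p x : int) : 0 < p -> p * x = 1 -> p = 1.
Proof.
move=> p0 /(congr1 absz); rewrite abszM => /eqP; rewrite muln_eq1.
by move=> /andP[/eqP]; lia.
Qed.

(** The shift changes the first coordinate by a combination of the other two, so coprimality of the
    parameters is enough for primitivity of the ideal. *)
Lemma gcdn_shifted (t : natriple) :
  gcdn (absz (shifted t).1.1) (gcdn (absz (shifted t).1.2) (absz (shifted t).2))
  = gcdn t.1.1 (gcdn t.1.2 t.2).
Proof.
case: t => [[p q] w].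
have -> : absz (shifted (p, q, w)).1.1 = (p + 2 * q + 2 * w)%N.
  by rewrite /shifted /=; lia.
rewrite /shifted /=.
set g := gcdn q w.
have /dvdnP[k kE] : (g %| 2 * q + 2 * w)%N.
  by rewrite dvdn_add // dvdn_mull // (dvdn_gcdl, dvdn_gcdr).
by rewrite -addnA kE gcdnC addnC gcdnMDl gcdnC.
Qed.

Lemma combination_le (R : realType) (k x y p q w p' q' w' : R) :
  0 <= x -> 0 <= y -> p <= k * p' -> q <= k * q' -> w <= k * w' ->
  p + q * x + w * y <= k * (p' + q' * x + w' * y).
Proof.
move=> x0 y0 hp hq hw; have := ler_wpM2r x0 hq; have := ler_wpM2r y0 hw.
by lra.
Qed.

Section totally_positive_family.
Variables (R : realType) (a : int) (r1 r2 r3 : R).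
Hypothesis roots : conjugate_roots a%:~R r1 r2 r3.

Lemma ev_shifted_gt0 (t : natriple) : (0 < t.1.1)%N ->
  [/\ 0 < ev r1 r2 (shifted t), 0 < ev r2 r3 (shifted t)
    & 0 < ev r3 r1 (shifted t)].
Proof.
rewrite !ev_shifted -(ltr0n R) => t0.
have [A8 _ _ _ _ g1 _ g2 _ g3 _ _ _ _] := roots.
by split; (apply: ltr_wpDr; [|apply: ltr_wpDr => //]);
  apply: mulr_ge0; rewrite ?ler0n //; lra.
Qed.

(** Since r1 + 2, r2 + 2, r3 + 2 are positive, a bound on the ratios of coordinates passes to the
    ratios of conjugates. Families therefore only have to be checked coordinatewise. *)
Lemma ev_shifted_ratio (t u : natriple) :
  t.1.1%:R <= a%:~R * u.1.1%:R :> R -> t.1.2%:R <= a%:~R * u.1.2%:R :> R ->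
  t.2%:R <= a%:~R * u.2%:R :> R ->
  [/\ ev r1 r2 (shifted t) <= a%:~R * ev r1 r2 (shifted u),
      ev r2 r3 (shifted t) <= a%:~R * ev r2 r3 (shifted u)
    & ev r3 r1 (shifted t) <= a%:~R * ev r3 r1 (shifted u)].
Proof.
move=> h1 h2 h3; rewrite !ev_shifted.
have [A8 _ _ _ _ g1 _ g2 _ g3 _ _ _ _] := roots.
by split; apply: combination_le => //; lra.
Qed.

(** The quotient v = t/u is a unit of the order with all conjugates in (0, a], so these differ by
    less than a. By [small_spread_int] v is an integer, and a positive integer that is a unit is
    1. *)
Lemma same_ideal_eq (t u : triple) :
  0 < ev r1 r2 t -> 0 < ev r2 r3 t -> 0 < ev r3 r1 t ->
  0 < ev r1 r2 u -> 0 < ev r2 r3 u -> 0 < ev r3 r1 u ->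
  ev r1 r2 t <= a%:~R * ev r1 r2 u ->
  ev r2 r3 t <= a%:~R * ev r2 r3 u ->
  ev r3 r1 t <= a%:~R * ev r3 r1 u ->
  multiples (adjoin_int r1) (ev r1 r2 t) =
  multiples (adjoin_int r1) (ev r1 r2 u) -> t = u.
Proof.
move=> t1 t2 t3 u1 u2 u3 h1 h2 h3 /(multiples_eq roots).
move=> [[v tE] [v' uE]].
have v1 : 0 < ev r1 r2 v <= a%:~R.
  move: t1 h1; rewrite tE (ev_tmul12 roots) pmulr_rgt0 // => ->.
  by rewrite mulrC ler_pM2r.
have v2 : 0 < ev r2 r3 v <= a%:~R.
  move: t2 h2; rewrite tE (ev_tmul23 roots) pmulr_rgt0 // => ->.
  by rewrite mulrC ler_pM2r.
have v3 : 0 < ev r3 r1 v <= a%:~R.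
  move: t3 h3; rewrite tE (ev_tmul31 roots) pmulr_rgt0 // => ->.
  by rewrite mulrC ler_pM2r.
have vE : v = (v.1.1, 0, 0).
  apply: (small_spread_int roots).
    by rewrite ltr_norml; lra.
  by rewrite ltr_norml; lra.
have p0 : 0 < v.1.1 by move: v1; rewrite vE ev_int ltr0z => /andP[].
have vv' : tmul a v v' = (1, 0, 0).
  apply: (ev_inj roots); rewrite (ev_tmul12 roots) ev_int.
  have u0 : ev r1 r2 u != 0 by rewrite gt_eqF.
  apply: (mulfI u0); rewrite mulrA mulr1 -!(ev_tmul12 roots) -tE.
  by rewrite -uE.
have p1 : v.1.1 = 1.
  move: vv'; rewrite vE; case: (v') => [[x y] z] /= [e _ _].
  have : v.1.1 * x = 1 by rewrite -e; ring.
  exact: pos_factor_of_1.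
by rewrite tE vE p1 (tmul1 roots).
Qed.

Lemma primitive_triple (t : triple) :
  gcdn (absz t.1.1) (gcdn (absz t.1.2) (absz t.2)) = 1%N ->
  primitive_ideal (adjoin_int r1)
    (multiples (adjoin_int r1) (ev r1 r2 t)).
Proof.
move=> g1 n n2 sub.
have : multiples (adjoin_int r1) n%:R (ev r1 r2 t).
  apply: sub; apply/(ev_multiples roots); exists (1, 0, 0).
  by rewrite (tmul1 roots).
rewrite pmulrn -(ev_int R r1 r2) => /(ev_multiples roots)[u].
move=> /(ev_inj roots) tE.
have dvd1 : (n %| 1)%N.
  rewrite -g1 tE; case: (u) => [[x y] z] /=; rewrite !dvdn_gcd.
  have dv (k l : int) : k = n%:Z * l -> (n %| absz k)%N.
    by move=> ->; rewrite abszM /= dvdn_mulr.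
  apply/and3P; split; [apply: (dv _ x)|apply: (dv _ y)|apply: (dv _ z)]; ring.
by move: dvd1; rewrite dvdn1 => /eqP n1; rewrite n1 in n2.
Qed.

Lemma family_le_counting (s : seq natriple) (x : R) : uniq s ->
  (forall t, t \in s -> [/\ (0 < t.1.1)%N,
     gcdn t.1.1 (gcdn t.1.2 t.2) = 1%N
     & ev r1 r2 (shifted t) * ev r2 r3 (shifted t)
       * ev r3 r1 (shifted t) <= x]) ->
  {in s &, forall t u, [/\ t.1.1%:R <= a%:~R * u.1.1%:R :> R,
     t.1.2%:R <= a%:~R * u.1.2%:R :> R & t.2%:R <= a%:~R * u.2%:R :> R]} ->
  ((size s)%:R%:E <= nb_primitive_principal (adjoin_int r1) x)%E.
Proof.
move=> us sP s_ratio.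
apply: (counting_ge_size R _ _ s
  (fun t => multiples (adjoin_int r1) (ev r1 r2 (shifted t)))) => //.
- move=> t u ts us' e; apply: shifted_inj.
  have [t0 _ _] := sP t ts; have [u0 _ _] := sP u us'.
  have [t1 t2 t3] := ev_shifted_gt0 t t0; have [u1 u2 u3] := ev_shifted_gt0 u u0.
  have [h1 h2 h3] := s_ratio t u ts us'.
  have [k1 k2 k3] := ev_shifted_ratio t u h1 h2 h3.
  exact: same_ideal_eq e.
- move=> t ts; have [t0 tg tx] := sP t ts.
  have [t1 t2 t3] := ev_shifted_gt0 t t0.
  have tn0 : shifted t != (0, 0, 0).
    by apply: contraTneq t1 => ->; rewrite ev_int ltxx.
  split.
  + by apply/(nonzero_ideal_triple roots); exists (shifted t).
  + by apply: primitive_triple; rewrite gcdn_shifted.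
  + rewrite (ideal_norm_triple roots) // lee_fin.
    rewrite -(ev_tnorm roots) in tx *.
    apply: le_trans tx; rewrite pmulrn ler_int gez0_abs //.
    by rewrite -(ler0z R) (ev_tnorm roots) !mulr_ge0 // ltW.
Qed.

End totally_positive_family.
Arguments family_le_counting {R a r1 r2 r3} roots.
Arguments primitive_triple {R a r1 r2 r3} roots.

Local Close Scope ring_scope.

(** * Coprime pairs *)

(** A union bound over the divisor 2 and all odd divisors 2k + 1 >= 3, prime or not. This is
    wasteful, but the odd part can be telescoped: 2 costs a proportion 1/4 of all pairs and the odd
    divisors at most another 1/4. *)
Lemma not_coprime_le (X m n : nat) : (0 < m <= X)%N -> (0 < n)%N ->
  (~~ coprime m n <= (2 %| m) * (2 %| n)
     + \sum_(1 <= k < X.+1) (k.*2.+1 %| m) * (k.*2.+1 %| n))%N.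
Proof.
move=> /andP[m0 mX] n0; case: (boolP (coprime m n)) => //= ncop.
have g0 : (0 < gcdn m n)%N by rewrite gcdn_gt0 m0.
have [even_g|odd_g] := boolP (2 %| gcdn m n)%N.
  by move: even_g; rewrite dvdn_gcd => /andP[-> ->].
set k := (gcdn m n)./2.
have kE : k.*2.+1 = gcdn m n.
  by rewrite -[RHS]odd_double_half -/k; move: odd_g; rewrite dvdn2 negbK => ->.
have k1 : (0 < k)%N by move: ncop; rewrite /coprime -kE; case: (k).
have kX : (k < X.+1)%N.
  have : (gcdn m n <= m)%N by apply: dvdn_leq => //; exact: dvdn_gcdl.
  by rewrite -kE; lia.
rewrite (bigD1_seq k) ?mem_index_iota ?k1 ?iota_uniq //=.
by rewrite kE dvdn_gcdl dvdn_gcdr addnCA leq_addr.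
Qed.

Lemma sum_not_coprime_le (X Y : nat) :
  (\sum_(1 <= m < X.+1) \sum_(1 <= n < Y.+1) ~~ coprime m n
   <= (X %/ 2) * (Y %/ 2)
      + \sum_(1 <= k < X.+1) (X %/ k.*2.+1) * (Y %/ k.*2.+1))%N.
Proof.
have sum_dvd d : (\sum_(1 <= m < X.+1) \sum_(1 <= n < Y.+1)
    (d %| m) * (d %| n) = (X %/ d) * (Y %/ d))%N.
  rewrite !divn_count_dvd big_distrl /=; apply: eq_bigr => m _.
  by rewrite big_distrr.
rewrite -sum_dvd; under [X in (_ <= _ + X)%N]eq_bigr do rewrite -sum_dvd.
rewrite [X in (_ <= _ + X)%N]exchange_big /= -big_split /=.
rewrite big_nat_cond [leqRHS]big_nat_cond; apply: leq_sum => m /andP[/andP[m1 mX] _].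
rewrite [X in (_ <= _ + X)%N]exchange_big /= -big_split /=.
rewrite big_nat_cond [leqRHS]big_nat_cond; apply: leq_sum => n /andP[/andP[n1 nY] _].
by apply: not_coprime_le; rewrite ?m1 ?n1.
Qed.

Local Open Scope ring_scope.

(* 1/(2k+1)^2 <= (1/k - 1/(k+1))/4 *)
Lemma sum_odd_div_le (X Y n : nat) :
  (\sum_(1 <= k < n.+1) (X %/ k.*2.+1) * (Y %/ k.*2.+1))%:R
  <= (X * Y)%:R / 4 * (1 - n.+1%:R^-1) :> rat.
Proof.
elim: n => [|n IHn]; first by rewrite big_geq // invr1 subrr mulr0.
rewrite big_nat_recr //= natrD.
have le_div Z : (Z %/ n.+1.*2.+1)%:R <= Z%:R / (n.+1.*2.+1)%:R :> rat.
  by rewrite ler_pdivlMr ?ltr0n // -natrM ler_nat leq_trunc_div.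
have := ler_pM (ler0n _ _) (ler0n _ _) (le_div X) (le_div Y).
rewrite -natrM => h; apply: le_trans (lerD IHn h) _.
have XY : 0 <= (X * Y)%:R :> rat by exact: ler0n.
have nE : n.+1.*2.+1%:R = 2 * n.+1%:R + 1 :> rat.
  by rewrite -muln2 -addn1 natrD natrM mulrC.
have n2E : n.+2%:R = n.+1%:R + 1 :> rat by rewrite -addn1 natrD.
have n0 : 1 <= n.+1%:R :> rat by rewrite ler1n.
rewrite {}nE {}n2E natrM in XY *; move: (n.+1%:R) n0 => t t1.
have -> : X%:R / (2 * t + 1) * (Y%:R / (2 * t + 1)) =
  X%:R * Y%:R * ((2 * t + 1) ^+ 2)^-1 by field; lra.
set w := ((2 * t + 1) ^+ 2)^-1.
have -> : X%:R * Y%:R / 4 * (1 - t^-1) + X%:R * Y%:R * w =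
  X%:R * Y%:R * (4^-1 * (1 - t^-1) + w) by ring.
rewrite -[X in _ <= X]mulrA; apply: ler_wpM2l => //; rewrite {}/w.
have -> : 4^-1 * (1 - (t + 1)^-1) =
  4^-1 * (1 - t^-1) + (4 * t * (t + 1))^-1 by field; lra.
by rewrite lerD2l lef_pV2 ?posrE; nra.
Qed.

Local Close Scope ring_scope.

Lemma sum_not_coprime_half (X Y : nat) :
  (2 * \sum_(1 <= m < X.+1) \sum_(1 <= n < Y.+1) ~~ coprime m n <= X * Y)%N.
Proof.
rewrite -(ler_nat rat) natrM.
have := sum_not_coprime_le X Y; rewrite -(ler_nat rat) natrD.
have := sum_odd_div_le X Y X.
have le_div Z : ((Z %/ 2)%:R <= Z%:R / 2 :> rat)%R.
  by rewrite ler_pdivlMr // -natrM ler_nat leq_trunc_div.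
have := ler_pM (ler0n _ _) (ler0n _ _) (le_div X) (le_div Y).
have XY : (0 <= (X * Y)%:R :> rat)%R by exact: ler0n.
have iX : (0 <= X.+1%:R^-1 :> rat)%R by rewrite invr_ge0.
have := mulr_ge0 XY iX.
rewrite !natrM; move: (_ X.+1%:R)%R => i.
move: ((X %/ 2)%:R)%R ((Y %/ 2)%:R)%R (X%:R)%R (Y%:R)%R => u v x y.
move: (\sum_(_ <= _ < _) _)%N => m; move: (\sum_(_ <= _ < _) _)%N => n.
by move: (m%:R)%R (n%:R)%R => s t h1 h2 h3 h4; lra.
Qed.

Definition coprime_pairs (A B : nat) : seq (nat * nat) :=
  [seq t <- [seq (m, n) | m <- index_iota A.+1 (8 * A).+1,
                          n <- index_iota B.+1 (8 * B).+1] | coprime t.1 t.2].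

Lemma coprime_pairsP (A B m n : nat) : (m, n) \in coprime_pairs A B ->
  [/\ (A < m <= 8 * A)%N, (B < n <= 8 * B)%N & coprime m n].
Proof.
rewrite mem_filter => /andP[/= cop /allpairsP[[m' n'] /=]].
by rewrite !mem_index_iota !ltnS => -[h1 h2 [e1 e2]]; subst.
Qed.

Lemma coprime_pairs_uniq (A B : nat) : uniq (coprime_pairs A B).
Proof.
by apply/filter_uniq/allpairs_uniq; rewrite ?iota_uniq // => -[? ?] [? ?].
Qed.

(** Of the 49 A B pairs of the window, at most half of the 64 A B pairs in the full box [1, 8A] x
    [1, 8B] fail to be coprime, which leaves 17 A B. *)
Lemma size_coprime_pairs (A B : nat) :
  (16 * (A * B) <= size (coprime_pairs A B))%N.
Proof.
have -> : size (coprime_pairs A B) = (\sum_(A.+1 <= m < (8 * A).+1)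
    \sum_(B.+1 <= n < (8 * B).+1) coprime m n)%N.
  rewrite size_filter -sum1_count big_mkcond big_allpairs.
  by apply: eq_bigr => m _; apply: eq_bigr => n _ /=; case: coprime.
have total : (\sum_(A.+1 <= m < (8 * A).+1) \sum_(B.+1 <= n < (8 * B).+1)
    (coprime m n + ~~ coprime m n) = (7 * A) * (7 * B))%N.
  under eq_bigr => m _ do under eq_bigr => n _ do
    have -> : (coprime m n + ~~ coprime m n = 1)%N by case: coprime.
  by rewrite !(big_const_nat, iter_addn_0, iter_addn); lia.
have le_full : (\sum_(A.+1 <= m < (8 * A).+1) \sum_(B.+1 <= n < (8 * B).+1)
    ~~ coprime m n <= \sum_(1 <= m < (8 * A).+1) \sum_(1 <= n < (8 * B).+1)
    ~~ coprime m n)%N.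
  rewrite [leqRHS](big_cat_nat (n := A.+1)) //=; last by lia.
  apply: leq_trans (leq_addl _ _); apply: leq_sum => m _.
  rewrite [leqRHS](big_cat_nat (n := B.+1)) //=; last by lia.
  exact: leq_addl.
have := sum_not_coprime_half (8 * A) (8 * B).
move: total; under eq_bigr do rewrite big_split /=.
rewrite big_split /=.
move: (\sum_(_ <= _ < _) _)%N le_full => x; move: (\sum_(_ <= _ < _) _)%N => y.
move: (\sum_(_ <= _ < _) _)%N => z.
nia.
Qed.

(** * Boxes at logarithmic scales *)

Local Open Scope ring_scope.

(* In the box (i, j), q ~ 8^i B, r ~ 8^j B and p ~ 8^(3m-i-j) B, so that the norm
   a^2 p q r does not depend on (i, j); p >= 8^m B keeps the conjugate
   p + q (r2 + 2) + r (r3 + 2) of order p. *)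
Definition box_scale (m B i j : nat) : nat := (B * 8 ^ (3 * m - i - j))%N.

Definition log_box (m B : nat) (ij : nat * nat) : seq natriple :=
  [seq (p, t.1, t.2) | t <- coprime_pairs (8 ^ ij.1 * B) (8 ^ ij.2 * B),
     p <- index_iota (box_scale m B ij.1 ij.2).+1
                     (2 * box_scale m B ij.1 ij.2).+1].

Definition log_family (m B : nat) : seq natriple :=
  [seq t | ij <- [seq (i, j) | i <- index_iota 0 m.+1, j <- index_iota 0 m.+1],
     t <- log_box m B ij].

Lemma mem_log_box (m B i j p q r : nat) :
  (p, q, r) \in log_box m B (i, j) ->
  [/\ (box_scale m B i j < p <= 2 * box_scale m B i j)%N,
      (8 ^ i * B < q <= 8 * (8 ^ i * B))%N,
      (8 ^ j * B < r <= 8 * (8 ^ j * B))%N & coprime q r].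
Proof.
move=> /allpairsP[[[q' r'] p'] /= [/coprime_pairsP[h1 h2 h3]]].
by rewrite mem_index_iota !ltnS => h4 [-> -> ->].
Qed.

Lemma mem_log_family (m B : nat) (t : natriple) :
  t \in log_family m B -> exists i j, [/\ (i <= m)%N, (j <= m)%N
    & t \in log_box m B (i, j)].
Proof.
move=> /allpairsPdep[[i j] [u [/allpairsP[[i' j'] /= [hi hj e]] ut ->]]].
move: hi hj; rewrite !mem_index_iota !ltnS => hi hj.
by case: e ut => -> -> ut; exists i', j'; split.
Qed.

(** The windows for different exponents are disjoint, so q and r determine the box (i, j) and no
    element is listed twice. *)
Lemma pow_window (i i' B q : nat) : (8 ^ i * B < q <= 8 * (8 ^ i * B))%N ->
  (8 ^ i' * B < q <= 8 * (8 ^ i' * B))%N -> (i <= i')%N.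
Proof.
move=> /andP[h1 _] /andP[_ h2]; rewrite leqNgt; apply/negP => lt.
have : (8 * (8 ^ i' * B) <= 8 ^ i * B)%N.
  by rewrite mulnA -expnS leq_mul2r leq_exp2l // lt orbT.
by lia.
Qed.

Lemma log_family_uniq (m B : nat) : uniq (log_family m B).
Proof.
apply: allpairs_uniq_dep.
- by apply: allpairs_uniq; rewrite ?iota_uniq // => -[? ?] [? ?].
- move=> [i j] _; apply: allpairs_uniq; rewrite ?iota_uniq ?coprime_pairs_uniq //.
  by move=> [[? ?] ?] [[? ?] ?] _ _ /= [-> -> ->].
- move=> [[i j] t] [[i' j'] t'] /allpairsPdep[ij [u [_ h1 e1]]].
  move=> /allpairsPdep[ij' [u' [_ h2 e2]]] /= e.
  have ijE : (i, j) = ij := congr1 (@tag _ _) e1.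
  have tE : t = u :=
    congr1 (fun z : {_ : nat * nat & natriple} => tagged z) e1.
  have ijE' : (i', j') = ij' := congr1 (@tag _ _) e2.
  have tE' : t' = u' :=
    congr1 (fun z : {_ : nat * nat & natriple} => tagged z) e2.
  rewrite -ijE -tE in h1; rewrite -ijE' -tE' -e in h2; rewrite -e.
  case: t {e e1 e2 tE tE'} h1 h2 => [[p q] r].
  move=> /mem_log_box[_ q1 w1 _] /mem_log_box[_ q2 w2 _].
  have -> : i = i'.
    apply/eqP; rewrite eqn_leq.
    by rewrite (pow_window _ _ _ _ q1 q2) (pow_window _ _ _ _ q2 q1).
  suff -> : j = j' by [].
  apply/eqP; rewrite eqn_leq.
  by rewrite (pow_window _ _ _ _ w1 w2) (pow_window _ _ _ _ w2 w1).
Qed.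

Lemma size_log_box (m B i j : nat) : (i <= m)%N -> (j <= m)%N ->
  (16 * (B ^ 3 * 8 ^ (3 * m)) <= size (log_box m B (i, j)))%N.
Proof.
move=> im jm; rewrite size_allpairs size_iota /=.
have -> : ((2 * box_scale m B i j).+1 - (box_scale m B i j).+1 =
  box_scale m B i j)%N by lia.
apply: leq_trans (leq_mul (size_coprime_pairs _ _) (leqnn _)).
(* The truncated subtraction is exact because i, j <= m. *)
rewrite /box_scale; have -> : (3 * m = i + j + (3 * m - i - j))%N by lia.
have -> : (i + j + (3 * m - i - j) - i - j = 3 * m - i - j)%N by lia.
rewrite !expnD; move: (8 ^ _)%N (8 ^ _)%N (8 ^ _)%N => x y z.
apply: eq_leq; ring.
Qed.

(** All (m + 1)^2 boxes satisfy the same lower bound on their size; with m of order log a this is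
    the origin of (log a)^2. *)
Lemma size_log_family (m B : nat) :
  ((m.+1 ^ 2) * (16 * (B ^ 3 * 8 ^ (3 * m))) <= size (log_family m B))%N.
Proof.
rewrite size_allpairs_dep sumnE big_map big_allpairs /=.
have -> : (m.+1 ^ 2 = \sum_(i <- index_iota 0 m.+1) \sum_(j <- index_iota 0 m.+1) 1)%N.
  by rewrite !(big_const_seq, iter_addn_0, count_predT, size_iota) subn0 mul1n mulnn.
rewrite big_distrl /= big_seq_cond [leqRHS]big_seq_cond.
apply: leq_sum => i; rewrite andbT mem_index_iota ltnS /= => im.
rewrite big_distrl /= big_seq_cond [leqRHS]big_seq_cond.
apply: leq_sum => j; rewrite andbT mem_index_iota ltnS /= => jm.
by rewrite mul1n size_log_box.
Qed.

Lemma box_scale_ge (m B i j k : nat) : (i <= m)%N -> (j <= m)%N -> (k <= m)%N ->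
  (8 ^ k * B <= box_scale m B i j)%N.
Proof.
move=> im jm km; rewrite mulnC /box_scale leq_mul2l; apply/orP; right.
by rewrite leq_exp2l //; lia.
Qed.

Lemma box_scale_le (m B i j : nat) : (box_scale m B i j <= B * 512 ^ m)%N.
Proof.
rewrite /box_scale leq_mul2l; apply/orP; right.
by rewrite -[512%N]/(8 ^ 3)%N -expnM leq_exp2l //; lia.
Qed.

Lemma box_product (m B i j : nat) : (i <= m)%N -> (j <= m)%N ->
  ((8 ^ i * B) * (8 ^ j * B) * box_scale m B i j = B ^ 3 * 8 ^ (3 * m))%N.
Proof.
move=> im jm; rewrite /box_scale.
have {2}-> : (3 * m = i + j + (3 * m - i - j))%N by lia.
by rewrite !expnD; move: (8 ^ _)%N (8 ^ _)%N (8 ^ _)%N => x y z; ring.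
Qed.

(** Coordinates from any two boxes have ratio at most 8 * 512^m, so the condition 8 * 512^m <= a
    makes all members of the family generate different ideals. *)
Lemma log_family_bounds (m B p q r : nat) : (p, q, r) \in log_family m B ->
  [/\ (B < p <= 2 * 512 ^ m * B)%N, (B < q <= 8 * 512 ^ m * B)%N
    & (B < r <= 8 * 512 ^ m * B)%N].
Proof.
move=> /mem_log_family[i [j [im jm]]].
move=> /mem_log_box[/andP[h1 h2] /andP[h3 h4] /andP[h5 h6] _].
have pow_le k : (k <= m)%N -> (8 * (8 ^ k * B) <= 8 * 512 ^ m * B)%N.
  move=> km; rewrite -mulnA leq_mul2l /= leq_mul2r; apply/orP; right.
  by rewrite -[512%N]/(8 ^ 3)%N -expnM leq_exp2l //; lia.
have B_le k : (B <= 8 ^ k * B)%N by rewrite leq_pmull // expn_gt0.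
split; apply/andP; split.
- apply: leq_ltn_trans h1; apply: leq_trans (B_le 0%N) _.
  exact: box_scale_ge.
- apply: leq_trans h2 _; rewrite -mulnA leq_mul2l /= mulnC.
  by rewrite mulnC [leqRHS]mulnC box_scale_le.
- exact: leq_ltn_trans h3.
- exact: leq_trans h4 (pow_le i im).
- exact: leq_ltn_trans h5.
- exact: leq_trans h6 (pow_le j jm).
Qed.

(** The factors have orders A u, P and A v: the coordinate multiplied by r1 + 2 dominates the first
    and the third, while the middle one has bounded coefficients. The hypotheses relating u, v and P
    absorb the remaining terms. *)
Lemma box_norm_le (R : realType) (A r1 r2 r3 P u v p q r : R) :
  conjugate_roots A r1 r2 r3 ->
  0 <= p -> 0 <= q -> 0 <= r -> p <= 2 * P -> q <= 8 * u -> r <= 8 * v ->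
  u <= P -> v <= P -> 8 * P <= A * u -> 8 * P <= A * v ->
  (p + q * (r1 + 2) + r * (r2 + 2)) * (p + q * (r2 + 2) + r * (r3 + 2))
  * (p + q * (r3 + 2) + r * (r1 + 2)) <= 15 * 26 * 15 * A ^+ 2 * (u * v * P).
Proof.
move=> [A8 _ _ _ _ g1 l1 g2 l2 g3 l3 _ _ _] p0 q0 r0 hp hq hr uP vP Pu Pv.
have u0 : 0 <= u by lra.
have v0 : 0 <= v by lra.
have P0 : 0 <= P by lra.
have [b1 b2 b3] : [/\ 0 <= r1 + 2, 0 <= r2 + 2 & 0 <= r3 + 2] by split; lra.
have [c1 c2 c3] : [/\ r1 + 2 <= A + 4, r2 + 2 <= 1 & r3 + 2 <= 2] by split; lra.
have q1 := ler_pM q0 b1 hq c1; have q2 := ler_pM q0 b2 hq c2.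
have q3 := ler_pM q0 b3 hq c3; have w1 := ler_pM r0 b1 hr c1.
have w2 := ler_pM r0 b2 hr c2; have w3 := ler_pM r0 b3 hr c3.
have Au : 8 * u <= A * u by rewrite ler_wpM2r.
have Av : 8 * v <= A * v by rewrite ler_wpM2r.
have e1 : p + q * (r1 + 2) + r * (r2 + 2) <= 15 * A * u by lra.
have e2 : p + q * (r2 + 2) + r * (r3 + 2) <= 26 * P by lra.
have e3 : p + q * (r3 + 2) + r * (r1 + 2) <= 15 * A * v by lra.
have i1 : 0 <= p + q * (r1 + 2) + r * (r2 + 2) by rewrite !addr_ge0 ?mulr_ge0.
have i2 : 0 <= p + q * (r2 + 2) + r * (r3 + 2) by rewrite !addr_ge0 ?mulr_ge0.
have i3 : 0 <= p + q * (r3 + 2) + r * (r1 + 2) by rewrite !addr_ge0 ?mulr_ge0.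
apply: le_trans (ler_pM (mulr_ge0 i1 i2) i3 (ler_pM i1 i2 e1 e2) e3) _.
by rewrite le_eqVlt; apply/orP; left; apply/eqP; ring.
Qed.

(** * Lower bounds from the families *)

Section lower_bounds.
Variables (R : realType) (a : int) (r1 r2 r3 : R).
Hypothesis roots : conjugate_roots a%:~R r1 r2 r3.

(** Elements p + q (rho + 2) with p, q coprime in (T, 8T] have norm of order at most a T^3. For T of
    order (x/a)^(1/3) their number is of order (x/a)^(2/3). *)
Lemma coprime_family_le_counting (T : nat) (x : R) :
  16 * 16 * 24 * a%:~R * T%:R ^+ 3 <= x ->
  (((16 * (T * T))%N%:R)%:E <= nb_primitive_principal (adjoin_int r1) x)%E.
Proof.
move=> Tx; pose s := [seq (t.1, t.2, 0%N) | t <- coprime_pairs T T].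
have [A8 _ _ _ _ g1 l1 g2 l2 g3 l3 _ _ _] := roots.
have s_mem t : t \in s -> [/\ (T < t.1.1 <= 8 * T)%N, (T < t.1.2 <= 8 * T)%N,
    t.2 = 0%N & coprime t.1.1 t.1.2].
  by move=> /mapP[[m n] /coprime_pairsP[h1 h2 h3] ->].
have sz : (16 * (T * T) <= size s)%N by rewrite size_map size_coprime_pairs.
apply: (@le_trans _ _ ((size s)%:R%:E)); first by rewrite lee_fin ler_nat.
apply: (family_le_counting roots).
- by rewrite map_inj_uniq ?coprime_pairs_uniq // => -[? ?] [? ?] /= [-> ->].
- move=> t /s_mem[/andP[h1 h2] /andP[h3 h4] h5 /eqP h6]; split.
  + by apply: leq_ltn_trans h1.
  + by rewrite h5 gcdn0.
  + rewrite !ev_shifted h5 !mul0r !addr0.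
    apply: le_trans Tx; move: h2 h4; rewrite -!(ler_nat R) !natrM.
    move: (t.1.1%:R) (t.1.2%:R) (ler0n R t.1.1) (ler0n R t.1.2) => p q p0 q0.
    move: (T%:R) (ler0n R T) => U U0 h2 h4.
    have e1 : p + q * (r1 + 2) <= 16 * U * a%:~R by nra.
    have e2 : p + q * (r2 + 2) <= 16 * U by nra.
    have e3 : p + q * (r3 + 2) <= 24 * U by nra.
    have i1 : 0 <= p + q * (r1 + 2) by nra.
    have i2 : 0 <= p + q * (r2 + 2) by nra.
    have i3 : 0 <= p + q * (r3 + 2) by nra.
    apply: le_trans (ler_pM (mulr_ge0 i1 i2) i3 (ler_pM i1 i2 e1 e2) e3) _.
    by rewrite le_eqVlt; apply/orP; left; apply/eqP; ring.
- move=> t u /s_mem[/andP[h1 h2] /andP[h3 h4] -> _].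
  move=> /s_mem[/andP[k1 k2] /andP[k3 k4] -> _]; rewrite mulr0.
  have ratio x' y : (x' <= 8 * T)%N -> (T < y)%N -> x'%:R <= a%:~R * y%:R :> R.
    move=> hx hy; apply: (@le_trans _ _ (8 * y%:R)).
      by rewrite -natrM ler_nat (leq_trans hx) // leq_mul2l (ltnW hy).
    by rewrite ler_wpM2r // ler0n.
  by split; rewrite ?ratio.
Qed.

Lemma log_family_le_counting (m B : nat) (x : R) :
  8 * 512 ^+ m <= a%:~R :> R ->
  15 * 26 * 15 * a%:~R ^+ 2 * (B ^ 3 * 8 ^ (3 * m))%N%:R <= x ->
  (((m.+1 ^ 2 * (16 * (B ^ 3 * 8 ^ (3 * m))))%N%:R)%:E
     <= nb_primitive_principal (adjoin_int r1) x)%E.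
Proof.
move=> ma Bx; set s := log_family m B.
have ma' (y : nat) : (8 * 512 ^ m * y)%N%:R <= a%:~R * y%:R :> R.
  by rewrite natrM ler_wpM2r ?ler0n // natrM natrX.
apply: (@le_trans _ _ ((size s)%:R%:E)).
  by rewrite lee_fin ler_nat size_log_family.
apply: (family_le_counting roots).
- exact: log_family_uniq.
- move=> [[p q] r] /mem_log_family[i [j [im jm]]].
  move=> /mem_log_box[/andP[h1 h2] /andP[h3 h4] /andP[h5 h6] /eqP h7]; split=> /=.
  + exact: leq_ltn_trans h1.
  + by rewrite h7 gcdn1.
  + apply: le_trans Bx; rewrite -(box_product m B i j im jm) !ev_shifted /=.
    have P_le k : (8 * box_scale m B i j)%N%:R <= a%:~R * (8 ^ k * B)%N%:R :> R.
      apply: le_trans (ma' _); rewrite ler_nat -mulnA leq_mul2l /=.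
      apply: leq_trans (box_scale_le _ _ _ _) _; rewrite mulnC leq_mul2l.
      by rewrite leq_pmull ?orbT // expn_gt0.
    rewrite !natrM; apply: (box_norm_le _ _ _ _ _ _ _ _ _ _ _ roots);
      rewrite ?ler0n // -?natrM ?ler_nat ?P_le ?box_scale_ge //.
- have ratio (x' y K : nat) : (x' <= K * 512 ^ m * B)%N -> (K <= 8)%N ->
      (B < y)%N -> x'%:R <= a%:~R * y%:R :> R.
    move=> hx K8 hy; apply: le_trans (ma' _); rewrite ler_nat.
    by apply: leq_trans hx _; rewrite !leq_mul // ltnW.
  move=> [[p q] r] [[p' q'] r'].
  move=> /log_family_bounds[/andP[_ h1] /andP[_ h2] /andP[_ h3]].
  move=> /log_family_bounds[/andP[k1 _] /andP[k2 _] /andP[k3 _]].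
  by split; [apply: ratio h1 _ k1|apply: ratio h2 _ k2|apply: ratio h3 _ k3].
Qed.
End lower_bounds.
Arguments coprime_family_le_counting {R a r1 r2 r3} roots.
Arguments log_family_le_counting {R a r1 r2 r3} roots.

(** * Reduction by units *)

(** A unit that is small where the element is largest, large where it is tiny and near 1 elsewhere
    lowers the sum of squares. The gap 2A gives |w3 e3| <= (A + 3)/(2A) |w1| <= 11/16 |w1|, and the
    increase is at most (1/81 + 19/81 + 121/256) w1^2 < w1^2 against the loss of w1^2. *)
Lemma unit_step_lt (R : realType) (A e1 e2 e3 w1 w2 w3 : R) : 8 <= A ->
  `|e1| <= 1 / 9 -> `|e2| <= 10 / 9 -> `|e3| <= A + 3 ->
  `|w2| <= `|w1| -> 2 * A * `|w3| < `|w1| ->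
  (w1 * e1) ^+ 2 + (w2 * e2) ^+ 2 + (w3 * e3) ^+ 2
    < w1 ^+ 2 + w2 ^+ 2 + w3 ^+ 2.
Proof.
move=> A8; have sq (x : R) : x ^+ 2 = `|x| ^+ 2 by rewrite real_normK ?num_real.
rewrite (sq (w1 * e1)) (sq (w2 * e2)) (sq (w3 * e3)) (sq w1) (sq w2) (sq w3).
rewrite !normrM {sq}.
move: (normr_ge0 e1) (normr_ge0 e2) (normr_ge0 e3).
move: (normr_ge0 w1) (normr_ge0 w2) (normr_ge0 w3).
move: `|e1| `|e2| `|e3| `|w1| `|w2| `|w3| => {e1 e2 e3 w1 w2 w3}.
move=> e1 e2 e3 w1 w2 w3 w10 w20 w30 e10 e20 e30 h1 h2 h3 le21 lt31.
have k1 : w1 * e1 <= w1 * (1 / 9) by rewrite ler_wpM2l.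
have k2 : w2 * e2 <= w2 * (10 / 9) by rewrite ler_wpM2l.
have k3 : w3 * e3 <= w1 * (11 / 16).
  have : w3 * e3 <= w3 * (A + 3) by rewrite ler_wpM2l.
  have : 3 * w3 <= 3 / 8 * (A * w3) by nra.
  lra.
have s1 : (w1 * e1) ^+ 2 <= (w1 * (1 / 9)) ^+ 2.
  by rewrite ler_sqr ?nnegrE ?mulr_ge0.
have s2 : (w2 * e2) ^+ 2 <= (w2 * (10 / 9)) ^+ 2.
  by rewrite ler_sqr ?nnegrE ?mulr_ge0.
have s3 : (w3 * e3) ^+ 2 <= (w1 * (11 / 16)) ^+ 2.
  by rewrite ler_sqr ?nnegrE ?mulr_ge0.
have s4 : w2 ^+ 2 <= w1 ^+ 2 by rewrite ler_sqr ?nnegrE.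
have w1_gt0 : 0 < w1.
  by apply: le_lt_trans lt31; rewrite !mulr_ge0 //; lra.
have s5 : 0 < w1 ^+ 2 by rewrite exprn_gt0.
have s6 := sqr_ge0 w3.
have t1 : (w1 * (1 / 9)) ^+ 2 = w1 ^+ 2 / 81 by field.
have t2 : (w2 * (10 / 9)) ^+ 2 = w2 ^+ 2 + w2 ^+ 2 * (19 / 81) by field.
have t3 : (w1 * (11 / 16)) ^+ 2 = w1 ^+ 2 * (121 / 256) by field.
rewrite {}t1 in s1; rewrite {}t2 in s2; rewrite {}t3 in s3.
clear -s1 s2 s3 s4 s5 s6; lra.
Qed.

Definition comparable_triple (R : realType) (A w1 w2 w3 : R) : Prop :=
  [/\ `|w1| <= 2 * A * `|w2| /\ `|w1| <= 2 * A * `|w3|,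
      `|w2| <= 2 * A * `|w1| /\ `|w2| <= 2 * A * `|w3|
    & `|w3| <= 2 * A * `|w1| /\ `|w3| <= 2 * A * `|w2|].
Arguments comparable_triple {R}.

Lemma comparable_or_gap (R : realType) (A w1 w2 w3 : R) : 8 <= A ->
  `|w2| <= `|w1| -> `|w3| <= `|w1| ->
  [\/ comparable_triple A w1 w2 w3,
      2 * A * `|w2| < `|w1| | 2 * A * `|w3| < `|w1|].
Proof.
move=> A8 h2 h3.
have [l2|l2] := leP `|w1| (2 * A * `|w2|); last by constructor 2.
have [l3|l3] := leP `|w1| (2 * A * `|w3|); last by constructor 3.
by constructor 1; split; split=> //; apply: le_trans (_ : `|w1| <= _) => //; nra.
Qed.

Lemma comparable_rot (R : realType) (A w1 w2 w3 : R) :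
  comparable_triple A w1 w2 w3 -> comparable_triple A w2 w3 w1.
Proof. by move=> [[? ?] [? ?] [? ?]]; split. Qed.

(** The last two hypotheses come from w1 - w2 and w3 - w2, in which q and r respectively have a
    coefficient of order A and the other one a coefficient near 1. Bounding the larger of q, r first
    decouples the system; the cross terms are then at most of order v2. *)
Lemma reduced_bounds (R : realType) (A q r v1 v2 v3 : R) : 8 <= A ->
  0 <= q -> 0 <= r -> 0 <= v2 -> v2 <= v1 -> v2 <= v3 ->
  v1 <= 2 * A * v2 -> v3 <= 2 * A * v2 ->
  q * (A + 2) - r * (91 / 90) <= v1 + v2 ->
  r * (A + 1) - q * (91 / 90) <= v3 + v2 ->
  [/\ q <= 3 * v2, r <= 3 * v2, A * q <= 7 * v1 & A * r <= 7 * v3].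
Proof.
move=> A8 q0 r0 v0 v21 v23 l1 l3 n1 n3.
have Av : 8 * v2 <= A * v2 by rewrite ler_wpM2r.
have [q3 r3] : q <= 3 * v2 /\ r <= 3 * v2.
  have [qr|rq] := leP q r.
    suff : r <= 3 * v2 by split => //; lra.
    have A0 : 0 < A - 1 / 90 by lra.
    by rewrite -(ler_pM2r A0); lra.
  suff : q <= 3 * v2 by split => //; lra.
  have A0 : 0 < A + 2 - 91 / 90 by lra.
  by rewrite -(ler_pM2r A0); lra.
by split=> //; lra.
Qed.

Section reduction.
Variables (R : realType) (a : int) (r1 r2 r3 : R).
Hypothesis roots : conjugate_roots a%:~R r1 r2 r3.

(** The sum of the squares of the conjugates, as an integer: its absolute value measures the descent
    in [ideal_comparable_generator]. *)
Definition square_trace (t : triple) : int := ttrace a (tmul a t t).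

Lemma ev_square_trace (t : triple) :
  (square_trace t)%:~R =
  ev r1 r2 t ^+ 2 + ev r2 r3 t ^+ 2 + ev r3 r1 t ^+ 2.
Proof.
have tr u : (ttrace a u)%:~R = ev r1 r2 u + ev r2 r3 u + ev r3 r1 u.
  case: u => [[p q] w]; rewrite /ev /= intrD !intrM intrD.
  by rewrite -(conj_sum roots); ring.
rewrite tr (ev_tmul12 roots) (ev_tmul23 roots).
by rewrite (ev_tmul31 roots).
Qed.

(** The units r1, r2, r3 and their inverses -1 - r2, -1 - r3, -1 - r1. Their triples of conjugates
    have sizes about a, 1, 1/a in all six orders, so [unit_step_lt] can be applied whatever the
    positions of the largest conjugate and of the gap. *)
Lemma ev_unit1 : [/\ ev r1 r2 (0, 1, 0) = r1,
    ev r2 r3 (0, 1, 0) = r2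
  & ev r3 r1 (0, 1, 0) = r3].
Proof.
by have := conj_sum roots; rewrite /ev /= ?intrD ?intrN; split; lra.
Qed.

Lemma ev_unit2 : [/\ ev r1 r2 (0, 0, 1) = r2,
    ev r2 r3 (0, 0, 1) = r3
  & ev r3 r1 (0, 0, 1) = r1].
Proof.
by have := conj_sum roots; rewrite /ev /= ?intrD ?intrN; split; lra.
Qed.

Lemma ev_unit3 : [/\ ev r1 r2 (a, -1, -1) = r3,
    ev r2 r3 (a, -1, -1) = r1
  & ev r3 r1 (a, -1, -1) = r2].
Proof.
by have := conj_sum roots; rewrite /ev /= ?intrD ?intrN; split; lra.
Qed.

Lemma ev_unit1V : [/\ ev r1 r2 (-1, 0, -1) = -1 - r2,
    ev r2 r3 (-1, 0, -1) = -1 - r3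
  & ev r3 r1 (-1, 0, -1) = -1 - r1].
Proof.
by have := conj_sum roots; rewrite /ev /= ?intrD ?intrN; split; lra.
Qed.

Lemma ev_unit2V : [/\ ev r1 r2 (-1 - a, 1, 1) = -1 - r3,
    ev r2 r3 (-1 - a, 1, 1) = -1 - r1
  & ev r3 r1 (-1 - a, 1, 1) = -1 - r2].
Proof.
by have := conj_sum roots; rewrite /ev /= ?intrD ?intrN; split; lra.
Qed.

Lemma ev_unit3V : [/\ ev r1 r2 (-1, -1, 0) = -1 - r1,
    ev r2 r3 (-1, -1, 0) = -1 - r2
  & ev r3 r1 (-1, -1, 0) = -1 - r3].
Proof.
by have := conj_sum roots; rewrite /ev /= ?intrD ?intrN; split; lra.
Qed.

Lemma unit1P : tmul a (0, 1, 0) (-1, 0, -1) = (1, 0, 0).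
Proof. by rewrite /=; congr (_, _, _); ring. Qed.

Lemma unit1VP : tmul a (-1, 0, -1) (0, 1, 0) = (1, 0, 0).
Proof. by rewrite /=; congr (_, _, _); ring. Qed.

Lemma unit2P : tmul a (0, 0, 1) (-1 - a, 1, 1) = (1, 0, 0).
Proof. by rewrite /=; congr (_, _, _); ring. Qed.

Lemma unit2VP : tmul a (-1 - a, 1, 1) (0, 0, 1) = (1, 0, 0).
Proof. by rewrite /=; congr (_, _, _); ring. Qed.

Lemma unit3P : tmul a (a, -1, -1) (-1, -1, 0) = (1, 0, 0).
Proof. by rewrite /=; congr (_, _, _); ring. Qed.

Lemma unit3VP : tmul a (-1, -1, 0) (a, -1, -1) = (1, 0, 0).
Proof. by rewrite /=; congr (_, _, _); ring. Qed.

Lemma square_trace_lt (t u : triple) :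
  (ev r1 r2 t * ev r1 r2 u) ^+ 2 + (ev r2 r3 t * ev r2 r3 u) ^+ 2
    + (ev r3 r1 t * ev r3 r1 u) ^+ 2
    < ev r1 r2 t ^+ 2 + ev r2 r3 t ^+ 2 + ev r3 r1 t ^+ 2 ->
  (absz (square_trace (tmul a t u)) < absz (square_trace t))%N.
Proof.
have ge0 v : 0 <= square_trace v.
  by rewrite -(ler0z R) ev_square_trace !addr_ge0 ?sqr_ge0.
rewrite -(ev_tmul12 roots) -(ev_tmul23 roots).
rewrite -(ev_tmul31 roots) -!ev_square_trace ltr_int.
by rewrite -ltz_nat !gez0_abs.
Qed.

(** If the conjugates are not comparable, the largest one exceeds another by a factor above 2a.
    These two positions select the unit among the six. *)
Lemma unit_reduction (t : triple) : t != (0, 0, 0) ->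
  ~ comparable_triple a%:~R (ev r1 r2 t) (ev r2 r3 t) (ev r3 r1 t) ->
  exists u v, tmul a u v = (1, 0, 0) /\
    (absz (square_trace (tmul a t u)) < absz (square_trace t))%N.
Proof.
move=> t0 ncmp.
have [A8 sum _ _ _ g1 l1 g2 l2 g3 l3 _ _ _] := roots.
have wlog_step u v : tmul a u v = (1, 0, 0) ->
    (ev r1 r2 t * ev r1 r2 u) ^+ 2 + (ev r2 r3 t * ev r2 r3 u) ^+ 2
    + (ev r3 r1 t * ev r3 r1 u) ^+ 2
    < ev r1 r2 t ^+ 2 + ev r2 r3 t ^+ 2 + ev r3 r1 t ^+ 2 ->
    exists u v, tmul a u v = (1, 0, 0) /\
      (absz (square_trace (tmul a t u)) < absz (square_trace t))%N.
  by move=> uv lt; exists u, v; split=> //; exact: square_trace_lt.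
have [e1 e2 e3] := ev_unit1; have [f1 f2 f3] := ev_unit2.
have [k1 k2 k3] := ev_unit3; have [e1' e2' e3'] := ev_unit1V.
have [f1' f2' f3'] := ev_unit2V; have [k1' k2' k3'] := ev_unit3V.
have [b1 b2 b3] : [/\ `|r1| <= a%:~R + 3, `|r2| <= 10 / 9 & `|r3| <= 1 / 9].
  by rewrite !ler_norml; split; lra.
have [c1 c2 c3] :
    [/\ `|-1 - r1| <= a%:~R + 3, `|-1 - r2| <= 1 / 9 & `|-1 - r3| <= 10 / 9].
  by rewrite !ler_norml; split; lra.
move: ncmp wlog_step; set w1 := ev r1 r2 t; set w2 := ev r2 r3 t.
set w3 := ev r3 r1 t => ncmp step.
have [[l12 l13]|[l21 l23]|[l31 l32]] :
    [\/ `|w2| <= `|w1| /\ `|w3| <= `|w1|, `|w1| <= `|w2| /\ `|w3| <= `|w2|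
      | `|w1| <= `|w3| /\ `|w2| <= `|w3|].
  have [l12|l12] := leP `|w1| `|w2|; have [l23|l23] := leP `|w2| `|w3|.
  - by constructor 3; split=> //; exact: le_trans l23.
  - by constructor 2; split=> //; exact: ltW.
  - have [l13|l13] := leP `|w1| `|w3|; first by constructor 3.
    by constructor 1; split; exact: ltW.
  - by constructor 1; split; [exact: ltW|exact: ltW (lt_trans l23 l12)].
- have [//|gap|gap] := comparable_or_gap _ _ _ _ _ A8 l12 l13.
  + apply: (step _ _ unit3P); rewrite k1 k2 k3.
    by have := unit_step_lt _ _ _ _ _ _ _ _ A8 b3 b2 b1 l13 gap; lra.
  + apply: (step _ _ unit1VP); rewrite e1' e2' e3'.
    by have := unit_step_lt _ _ _ _ _ _ _ _ A8 c2 c3 c1 l12 gap; lra.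
- have [/comparable_rot/comparable_rot//|gap|gap] := comparable_or_gap _ _ _ _ _ A8 l23 l21.
  + apply: (step _ _ unit2P); rewrite f1 f2 f3.
    by have := unit_step_lt _ _ _ _ _ _ _ _ A8 b3 b2 b1 l21 gap; lra.
  + apply: (step _ _ unit3VP); rewrite k1' k2' k3'.
    by have := unit_step_lt _ _ _ _ _ _ _ _ A8 c2 c3 c1 l23 gap; lra.
- have [/comparable_rot//|gap|gap] := comparable_or_gap _ _ _ _ _ A8 l31 l32.
  + apply: (step _ _ unit1P); rewrite e1 e2 e3.
    by have := unit_step_lt _ _ _ _ _ _ _ _ A8 b3 b2 b1 l32 gap; lra.
  + apply: (step _ _ unit2VP); rewrite f1' f2' f3'.
    by have := unit_step_lt _ _ _ _ _ _ _ _ A8 c2 c3 c1 l31 gap; lra.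
Qed.

Lemma ideal_comparable_generator (t : triple) : t != (0, 0, 0) ->
  exists2 u : triple, u != (0, 0, 0) &
    multiples (adjoin_int r1) (ev r1 r2 u) =
    multiples (adjoin_int r1) (ev r1 r2 t) /\
    comparable_triple a%:~R (ev r1 r2 u) (ev r2 r3 u) (ev r3 r1 u).
Proof.
have [n] := ubnP (absz (square_trace t)).
elim: n t => // n IHn t tn t0.
have [cmp|ncmp] := pselect (comparable_triple a%:~R
  (ev r1 r2 t) (ev r2 r3 t) (ev r3 r1 t)); first by exists t.
have [u [v [uv lt]]] := unit_reduction t t0 ncmp.
have tu0 : tmul a t u != (0, 0, 0).
  have [t1 _ _] := ev_neq0 roots t t0.
  apply: contraNneq t1 => tu; rewrite -(tmul1 roots t) -uv.
  rewrite (tmulA roots) tu.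
  by rewrite (ev_tmul12 roots) ev_int mul0r.
have [|w w0 [wE wc]] := IHn (tmul a t u) _ tu0.
  by apply: leq_trans lt _; rewrite -ltnS.
by exists w => //; split=> //; rewrite wE (multiples_unit roots _ _ v).
Qed.

Lemma tconj3 (t : triple) : tconj a (tconj a (tconj a t)) = t.
Proof. by case: t => [[p q] w] /=; congr (_, _, _); ring. Qed.

Lemma reduced_estimates (t : triple) :
  `|ev r2 r3 t| <= `|ev r1 r2 t| -> `|ev r2 r3 t| <= `|ev r3 r1 t| ->
  `|ev r1 r2 t| <= 2 * a%:~R * `|ev r2 r3 t| ->
  `|ev r3 r1 t| <= 2 * a%:~R * `|ev r2 r3 t| ->
  [/\ (absz t.1.2)%:R <= 3 * `|ev r2 r3 t|,
      (absz t.2)%:R <= 3 * `|ev r2 r3 t|,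
      a%:~R * (absz t.1.2)%:R <= 7 * `|ev r1 r2 t|
    & a%:~R * (absz t.2)%:R <= 7 * `|ev r3 r1 t|].
Proof.
have [A8 _ _ _ _ g1 l1 g2 l2 g3 l3 g32 l32 g132] := roots.
case: t => [[p q] r]; rewrite /= !natr_absz !intr_norm.
set w1 := ev r1 r2 _; set w2 := ev r2 r3 _; set w3 := ev r3 r1 _.
set Q : R := q%:~R; set W : R := r%:~R; set A : R := a%:~R in A8 g1 l1 g132 *.
have d12 : w1 - w2 = Q * (r1 - r2) - W * (r3 - r2).
  by rewrite /w1 /w2 /ev /=; ring.
have d32 : w3 - w2 = Q * (r3 - r2) + W * (r1 - r3).
  by rewrite /w3 /w2 /ev /=; ring.
have n12 : `|Q| * (A + 2) - `|W| * (91 / 90) <= `|w1| + `|w2|.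
  have h : `|Q| * (r1 - r2) - `|W| * (r3 - r2) <= `|w1 - w2|.
    rewrite d12; apply: le_trans (lerB_dist _ _).
    by rewrite !normrM (gtr0_norm (_ : 0 < r1 - r2)) ?(gtr0_norm (_ : 0 < r3 - r2)) //; lra.
  have := ler_normB w1 w2; have := normr_ge0 Q; have := normr_ge0 W.
  move=> W0 Q0.
  have : `|Q| * (A + 2) <= `|Q| * (r1 - r2) by rewrite ler_wpM2l //; lra.
  have : `|W| * (r3 - r2) <= `|W| * (91 / 90) by rewrite ler_wpM2l //; lra.
  lra.
have n32 : `|W| * (A + 1) - `|Q| * (91 / 90) <= `|w3| + `|w2|.
  have h : `|W| * (r1 - r3) - `|Q| * (r3 - r2) <= `|w3 - w2|.
    have -> : w3 - w2 = W * (r1 - r3) - - (Q * (r3 - r2)) by rewrite d32; ring.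
    apply: le_trans (lerB_dist _ _).
    by rewrite normrN !normrM (gtr0_norm (_ : 0 < r1 - r3)) ?(gtr0_norm (_ : 0 < r3 - r2)) //; lra.
  have := ler_normB w3 w2; have := normr_ge0 Q; have := normr_ge0 W.
  move=> W0 Q0.
  have : `|W| * (A + 1) <= `|W| * (r1 - r3) by rewrite ler_wpM2l //; lra.
  have : `|Q| * (r3 - r2) <= `|Q| * (91 / 90) by rewrite ler_wpM2l //; lra.
  lra.
by move=> h1 h2 h3 h4; apply: reduced_bounds.
Qed.

End reduction.
Arguments ideal_comparable_generator {R a r1 r2 r3} roots.
Arguments reduced_estimates {R a r1 r2 r3} roots.

(** Covering by a list rather than exact cardinality: unions and images then need neither
    disjointness nor injectivity, and a real bound n can be taken directly from the estimates. *)
Definition atmost (R : realType) (T : eqType) (n : R) (S : set T) : Prop :=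
  exists2 s : seq T, (size s)%:R <= n & forall y, S y -> y \in s.

(** * Counting reduced elements *)

Lemma absz0P (z : int) : absz z = 0%N -> z = 0.
Proof. by move/eqP; rewrite absz_eq0 => /eqP. Qed.

Lemma atmost_sub (R : realType) (T : eqType) (n n' : R) (S S' : set T) :
  (forall y, S' y -> S y) -> n <= n' -> atmost R T n S -> atmost R T n' S'.
Proof.
move=> sub nn' [s sn sS]; exists s; first exact: le_trans sn nn'.
by move=> y /sub/sS.
Qed.

Lemma atmost_empty (R : realType) (T : eqType) (n : R) (S : set T) :
  0 <= n -> (forall y, ~ S y) -> atmost R T n S.
Proof. by move=> n0 S0; exists [::] => // y /S0. Qed.

Lemma atmostU (R : realType) (T : eqType) (n n' : R) (S S' : set T) :
  atmost R T n S -> atmost R T n' S' ->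
  atmost R T (n + n') [set y | S y \/ S' y]%classic.
Proof.
move=> [s sn sS] [s' sn' sS']; exists (s ++ s').
  by rewrite size_cat natrD lerD.
by move=> y [/sS|/sS'] h; rewrite mem_cat h ?orbT.
Qed.

Lemma atmost_image (R : realType) (T T' : eqType) (n : R) (S : set T)
    (f : T -> T') :
  atmost R T n S -> atmost R T' n (fun y => exists2 x, S x & y = f x).
Proof.
move=> [s sn sS]; exists [seq f x | x <- s]; first by rewrite size_map.
by move=> y [x /sS xs ->]; exact: map_f.
Qed.

Lemma atmost_bigcup (R : realType) (I T : eqType) (r : seq I) (n : I -> R)
    (S : I -> set T) :
  (forall i, i \in r -> atmost R T (n i) (S i)) ->
  atmost R T (\sum_(i <- r) n i) (fun y => exists2 i, i \in r & S i y).
Proof.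
elim: r => [|i r IHr] h.
  by apply: atmost_empty => [|y []//]; rewrite big_nil.
rewrite big_cons; have h1 := h i (mem_head _ _).
have h2 := IHr (fun j jr => h j (mem_behead (s := i :: r) jr)).
apply: atmost_sub (lexx _) (atmostU _ _ _ _ _ _ h1 h2) => y [j].
by rewrite inE => /predU1P[->|jr] Sy; [left|right; exists j].
Qed.

Lemma atmost_counting (R : realType) (T : choiceType) (n : R) (S : set T) :
  atmost R T n S -> (counting S <= n%:E)%E.
Proof.
move=> [s sn sS]; apply: le_trans (_ : (size s)%:R%:E <= _)%E.
  by apply: (counting_le_size R T T s id) => y /sS; exists y.
by rewrite lee_fin.
Qed.

Lemma atmost_int_near (R : realType) (c V : R) : 0 <= V ->
  atmost R int (2 * V + 2) (fun p => `|p%:~R + c| <= V).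
Proof.
move=> V0; pose lo := Num.floor (- c - V); pose n := Num.truncn (2 * V + 1).
exists [seq lo + k%:Z | k <- iota 0 n.+1].
  rewrite size_map size_iota -addn1 natrD -lerBrDr.
  have : n%:R <= 2 * V + 1 by rewrite truncn_le; lra.
  lra.
move=> p; rewrite ler_norml => /andP[h1 h2].
have lo_le : lo%:~R <= - c - V := floor_le _.
have lo_gt := floorD1_gt (- c - V); rewrite -/lo intrD in lo_gt.
have lop : lo <= p by rewrite -(ler_int R); lra.
apply/mapP; exists (absz (p - lo)); last by rewrite gez0_abs ?subr_ge0 // subrKC.
rewrite mem_iota /= add0n ltnS truncn_ge_nat; last by lra.
by rewrite natr_absz ger0_norm ?subr_ge0 // intrB; lra.
Qed.

(** A discrete integral comparison: with v = X + D (n + 1) and u = v - D, ln (u/v) = ln (1 - D/v) <=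
    -D/v. *)
Lemma sum_inv_affine_le (R : realType) (X D : R) (n : nat) : 0 < X -> 0 < D ->
  \sum_(1 <= k < n.+1) D / (X + D * k%:R) <= ln ((X + D * n%:R) / X).
Proof.
move=> X0 D0; have pos k : 0 < X + D * k%:R.
  by rewrite ltr_wpDr // mulr_ge0 ?ler0n // ltW.
elim: n => [|n IHn].
  by rewrite big_geq // mulr0 addr0 divff ?gt_eqF // ln1.
rewrite big_nat_recr //=; apply: le_trans (lerD IHn (lexx _)) _.
have q0 k : 0 < (X + D * k%:R) / X by rewrite divr_gt0.
set u := X + D * n%:R; set v := X + D * n.+1%:R.
have u0 : 0 < u := pos n; have v0 : 0 < v := pos n.+1.
have vE : v = u + D by rewrite /v /u -addn1 natrD; ring.
have lnE : ln (u / X) = ln (v / X) + ln (1 + (- D / v)).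
  rewrite -lnM ?posrE ?divr_gt0 //.
    by congr ln; rewrite vE; field; rewrite -vE !gt_eqF.
  by rewrite vE (_ : 1 + _ = u / v) ?divr_gt0 // vE; field; rewrite -vE gt_eqF.
rewrite lnE -lerBrDr.
have le_ln : ln (1 + - D / v) <= - D / v.
  apply: le_ln1Dx; rewrite vE (_ : - D / (u + D) = u / v - 1).
    by rewrite ltrBrDr addrC subrr divr_gt0.
  by rewrite vE; field; rewrite -vE gt_eqF.
by move: le_ln; rewrite mulNr; lra.
Qed.

Lemma sum_inv_sqrt_le (R : realType) (n : nat) :
  \sum_(1 <= k < n.+1) (Num.sqrt (k%:R : R))^-1 <= 2 * Num.sqrt n%:R.
Proof.
elim: n => [|n IHn]; first by rewrite big_geq // sqrtr0 mulr0.
rewrite big_nat_recr //=; apply: le_trans (lerD IHn (lexx _)) _.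
have s0 := sqrtr_ge0 (n%:R : R).
have t0 : 0 < Num.sqrt (n.+1%:R : R) by rewrite sqrtr_gt0 ltr0n.
have s2 := sqr_sqrtr (ler0n R n).
have t2 : Num.sqrt (n.+1%:R : R) ^+ 2 = n%:R + 1.
  by rewrite sqr_sqrtr ?ler0n // natr1.
move: (Num.sqrt n%:R) (Num.sqrt n.+1%:R) s0 t0 s2 t2 => s t s0 t0 s2 t2.
have i0 : 0 < t^-1 by rewrite invr_gt0.
have it : t * t^-1 = 1 by rewrite divff ?gt_eqF.
(* As t^2 = s^2 + 1, expanding this gives 1/t <= 2 (t - s), which telescopes. *)
have : 0 <= t^-1 * (t - s) ^+ 2 by rewrite mulr_ge0 ?sqr_ge0 // ltW.
have -> : t^-1 * (t - s) ^+ 2 = t * t^-1 * t - 2 * s * (t * t^-1) + t^-1 * s ^+ 2.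
  by ring.
have -> : s ^+ 2 = t * t - 1 by rewrite -expr2 t2 s2; ring.
have -> : t * t^-1 * t - 2 * s * (t * t^-1) + t^-1 * (t * t - 1) =
    t * t^-1 * (2 * t - 2 * s) - t^-1 by ring.
by rewrite it; lra.
Qed.

Section reduced_count.
Variables (R : realType) (a : int) (r1 r2 r3 : R).
Hypothesis roots : conjugate_roots a%:~R r1 r2 r3.

(** The least conjugate is placed at [ev r2 r3] because r2 and r3 are bounded: for given q and r its
    size determines the range of p. *)
Definition reduced (x : R) : set triple := fun t =>
  [/\ t != (0, 0, 0), `|ev r2 r3 t| <= `|ev r1 r2 t|,
      `|ev r2 r3 t| <= `|ev r3 r1 t|,
      `|ev r1 r2 t| <= 2 * a%:~R * `|ev r2 r3 t|
        /\ `|ev r3 r1 t| <= 2 * a%:~R * `|ev r2 r3 t|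
    & `|ev r1 r2 t| * `|ev r2 r3 t| * `|ev r3 r1 t| <= x].

(** Four choices of signs, each with p in an interval of length 2V, give 4 (2V + 2). This is at most
    32 V once V >= 1/3; for smaller V the set is empty, because k or l is at least 1. *)
Lemma atmost_slice (k l : nat) (V : R) : 0 <= V -> (0 < k + l)%N ->
  atmost R triple (32 * V) (fun t =>
    [/\ absz t.1.2 = k, absz t.2 = l, k%:R <= 3 * `|ev r2 r3 t|,
        l%:R <= 3 * `|ev r2 r3 t| & `|ev r2 r3 t| <= V]).
Proof.
move=> V0 kl; have [V3|V3] := ltP V (1 / 3).
  apply: atmost_empty => [|t [_ _ h1 h2 h3]]; first lra.
  have [k0|l0] : (0 < k)%N \/ (0 < l)%N by move: kl; rewrite addn_gt0 => /orP.
    have : 1 <= k%:R :> R by rewrite ler1n.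
    lra.
  have : 1 <= l%:R :> R by rewrite ler1n.
  lra.
have sl q r := atmost_image _ _ _ _ _ (fun p : int => (p, q, r) : triple)
  (atmost_int_near R (q%:~R * r2 + r%:~R * r3) V V0).
have h := atmostU _ _ _ _ _ _
  (atmostU _ _ _ _ _ _ (sl k%:Z l%:Z) (sl k%:Z (- l%:Z)))
  (atmostU _ _ _ _ _ _ (sl (- k%:Z) l%:Z) (sl (- k%:Z) (- l%:Z))).
apply: atmost_sub h; last by lra.
move=> [[p q] r] /= [qk rl _ _]; rewrite /ev /= -addrA => pV.
have absE (z : int) (n : nat) : absz z = n -> z = n%:Z \/ z = - n%:Z.
  by move=> <-; case: (z) => m; [left|right].
move: pV; case: (absE _ _ qk) => ->; case: (absE _ _ rl) => -> pV;
  [left; left|left; right|right; left|right; right]; by exists p.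
Qed.

(** The estimates a |q| <= 7 |w1| and a |r| <= 7 |w3| are multiplied by powers of |w2| until the
    norm w1 w2 w3 appears, using that |w2| is the least. *)
Lemma reduced_slice (x : R) (t : triple) : reduced x t ->
  [/\ (absz t.1.2)%:R <= 3 * `|ev r2 r3 t|,
      (absz t.2)%:R <= 3 * `|ev r2 r3 t|,
      a%:~R * (absz t.1.2)%:R * `|ev r2 r3 t| ^+ 2 <= 7 * x,
      a%:~R * (absz t.2)%:R * `|ev r2 r3 t| ^+ 2 <= 7 * x
    & [/\ `|ev r2 r3 t| ^+ 3 <= x & a%:~R ^+ 2 * (absz t.1.2)%:R
         * (absz t.2)%:R * `|ev r2 r3 t| <= 49 * x]].
Proof.
move=> [_ h1 h3 [g1 g3] hx].
have [q3 r3' aq ar] := reduced_estimates roots t h1 h3 g1 g3.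
have A0 : 0 <= a%:~R :> R by have := conj_ge8 roots; lra.
have q0 : 0 <= (absz t.1.2)%:R :> R := ler0n _ _.
have r0 : 0 <= (absz t.2)%:R :> R := ler0n _ _.
have v0 := normr_ge0 (ev r2 r3 t).
move: (absz t.1.2)%:R (absz t.2)%:R q0 r0 q3 r3' aq ar.
move: `|ev r1 r2 t| `|ev r2 r3 t| `|ev r3 r1 t| h1 h3 {g1 g3} hx v0.
move: (a%:~R) A0 => A A0 v1 v2 v3 h1 h3 hx v0 q r q0 r0 q3 r3' aq ar.
have v1_ge0 : 0 <= v1 := le_trans v0 h1.
have v3_ge0 : 0 <= v3 := le_trans v0 h3.
have Aq0 : 0 <= A * q := mulr_ge0 A0 q0.
have Ar0 : 0 <= A * r := mulr_ge0 A0 r0.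
have le_of u v : 0 <= u -> u <= 7 * v -> v2 <= v -> forall w, 0 <= w -> v2 <= w ->
    u * v2 ^+ 2 <= 7 * (v * v2 * w).
  move=> u0 uv v2v w w0 v2w; have := ler_pM u0 v0 uv (lexx v2) => h.
  have := ler_pM (mulr_ge0 u0 v0) v0 h v2w.
  by rewrite expr2; lra.
split=> //.
- by apply: le_trans (le_of _ _ Aq0 aq h1 _ v3_ge0 h3) _; rewrite ler_wpM2l.
- apply: le_trans (le_of _ _ Ar0 ar h3 _ v1_ge0 h1) _.
  have -> : v3 * v2 * v1 = v1 * v2 * v3 by ring.
  by rewrite ler_wpM2l.
- split.
    apply: le_trans hx; rewrite exprSr expr2.
    by apply: ler_pM => //; rewrite ?mulr_ge0 // ler_wpM2r.
  have := ler_pM (mulr_ge0 Aq0 v0) Ar0 (ler_pM Aq0 v0 aq (lexx v2)) ar.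
  have -> : A * q * v2 * (A * r) = A ^+ 2 * q * r * v2 by ring.
  have -> : 7 * v1 * v2 * (7 * v3) = 49 * (v1 * v2 * v3) by ring.
  by move=> h; apply: le_trans h _; rewrite ler_wpM2l.
Qed.

(* X + A^2 k interpolates between the two bounds V <= X and
   A^2 k l V <= 49 X^3 on V = |ev2 t|, so that the sum over k, l factors. *)
Lemma interpolated_bound (A X k l V : R) : 8 <= A -> 0 < X ->
  0 <= k -> 0 <= l -> 0 <= V ->
  k <= 3 * V -> l <= 3 * V -> V ^+ 3 <= X ^+ 3 ->
  A ^+ 2 * k * l * V <= 49 * X ^+ 3 ->
  V <= 56 * X ^+ 3 / A ^+ 2 * (A ^+ 2 / (X + A ^+ 2 * k))
       * (A ^+ 2 / (X + A ^+ 2 * l)).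
Proof.
move=> A8 X0 k0 l0 V0 kV lV VX klV.
have X0' := ltW X0.
have {}VX : V <= X by move: VX; rewrite ler_pXn2r ?nnegrE.
have A20 : 0 < A ^+ 2 by rewrite exprn_gt0 //; lra.
have A21 : 1 <= A ^+ 2 by rewrite expr_ge1 //; lra.
have d1 : 0 < X + A ^+ 2 * k by rewrite ltr_wpDr // mulr_ge0 // ltW.
have d2 : 0 < X + A ^+ 2 * l by rewrite ltr_wpDr // mulr_ge0 // ltW.
move: (A ^+ 2) A20 A21 d1 d2 klV => D D0 D1 d1 d2 klV.
have -> : 56 * X ^+ 3 / D * (D / (X + D * k)) * (D / (X + D * l)) =
    56 * X ^+ 3 * D / ((X + D * k) * (X + D * l)).
  by field; rewrite !gt_eqF.
rewrite ler_pdivlMr ?mulr_gt0 //.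
have kX : k <= 3 * X by lra.
have lX : l <= 3 * X by lra.
have t1 : V * X * X <= X * X * X by rewrite !ler_wpM2r // ltW.
have t2 : V * X * (D * (k + l)) <= X * X * (D * (6 * X)).
  have D0' := ltW D0; have kl0 := addr_ge0 k0 l0.
  apply: (ler_pM (mulr_ge0 V0 X0') (mulr_ge0 D0' kl0)).
    by rewrite ler_wpM2r.
  by rewrite ler_wpM2l //; lra.
have t3 := ler_wpM2l (ltW D0) klV.
have t4 : X ^+ 3 <= X ^+ 3 * D by rewrite ler_peMr // exprn_ge0 // ltW.
have -> : V * ((X + D * k) * (X + D * l)) =
  V * X * X + V * X * (D * (k + l)) + D * (D * k * l * V) by ring.
have -> : 56 * X ^+ 3 * D = X ^+ 3 * D + X * X * (D * (6 * X)) + D * (49 * X ^+ 3).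
  by ring.
rewrite !lerD //; apply: le_trans t1 _; rewrite -expr2 -exprSr; exact: t4.
Qed.

Lemma atmost_reduced_both (X : R) : 1 <= X ->
  atmost R triple ((32 * 56 * 9) * (ln a%:~R ^+ 2 * X ^+ 3 / a%:~R ^+ 2))
    (fun t => [/\ reduced (X ^+ 3) t, absz t.1.2 != 0%N & absz t.2 != 0%N]).
Proof.
move=> X1; have X0 : 0 < X by lra.
have A8 : 8 <= a%:~R :> R := conj_ge8 roots.
have A20 : 0 < a%:~R ^+ 2 :> R by rewrite exprn_gt0 //; lra.
(* Both |q| and |r| are at most 3 |ev r2 r3 t| <= 3 X. *)
pose N := Num.truncn (3 * X).
have NX : N%:R <= 3 * X by rewrite truncn_le; lra.
pose g (k : nat) : R := a%:~R ^+ 2 / (X + a%:~R ^+ 2 * k%:R).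
have g0 k : 0 <= g k.
  apply: divr_ge0; first exact: ltW.
  by apply: addr_ge0; [exact: ltW|apply: mulr_ge0; [exact: ltW|exact: ler0n]].
pose C : R := 56 * X ^+ 3 / a%:~R ^+ 2.
have C0 : 0 <= C.
  apply: divr_ge0; last exact: ltW.
  by apply: mulr_ge0 => //; apply: exprn_ge0; exact: ltW.
have h1 k l : (0 < k)%N -> _ := fun k0 => atmost_slice k l (C * g k * g l)
  (mulr_ge0 (mulr_ge0 C0 (g0 k)) (g0 l)) (ltn_addr l k0).
have h2 k : k \in index_iota 1 N.+1 -> _ := fun kN =>
  atmost_bigcup _ _ _ (index_iota 1 N.+1) _ _
    (fun l _ => h1 k l (proj1 (andP (etrans (esym (mem_index_iota _ _ _)) kN)))).
have h3 := atmost_bigcup _ _ _ (index_iota 1 N.+1) _ _ h2.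
apply: atmost_sub h3.
  move=> t [tx q0 r0]; have [qV rV _ _ [VX qrV]] := reduced_slice _ _ tx.
  have V0 := normr_ge0 (ev r2 r3 t).
  have VX' : `|ev r2 r3 t| <= X.
    by move: VX; rewrite ler_pXn2r ?nnegrE // ltW.
  have le_N (k : nat) : k%:R <= 3 * `|ev r2 r3 t| -> k != 0%N ->
      k \in index_iota 1 N.+1.
    move=> kV k0; rewrite mem_index_iota lt0n k0 ltnS truncn_ge_nat; lra.
  exists (absz t.1.2); first exact: le_N.
  exists (absz t.2); first exact: le_N.
  split=> //; exact: interpolated_bound.
have -> : \sum_(k <- index_iota 1 N.+1) \sum_(l <- index_iota 1 N.+1)
    32 * (C * g k * g l) = 32 * C * (\sum_(1 <= k < N.+1) g k) ^+ 2.
  rewrite expr2 mulr_suml mulr_sumr; apply: eq_bigr => k _.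
  by rewrite 2!mulr_sumr; apply: eq_bigr => l _; ring.
have G0 : 0 <= \sum_(1 <= k < N.+1) g k by apply: sumr_ge0.
have G3 : \sum_(1 <= k < N.+1) g k <= 3 * ln a%:~R.
  apply: le_trans (sum_inv_affine_le _ _ _ _ X0 A20) _.
  have -> : 3 * ln a%:~R = ln (a%:~R ^+ 3) :> R.
    by rewrite lnXn ?mulr_natl //; lra.
  (* N <= 3X bounds the quotient by 1 + 3 a^2, so each of the two sums is at most 3 ln a. *)
  have le3 : (X + a%:~R ^+ 2 * N%:R) / X <= a%:~R ^+ 3.
    rewrite ler_pdivrMr //.
    have : a%:~R ^+ 2 * N%:R <= a%:~R ^+ 2 * (3 * X).
      by rewrite ler_wpM2l // ltW.
    have : X + a%:~R ^+ 2 * (3 * X) <= a%:~R ^+ 3 * X.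
      rewrite (exprSr _ 2); have : 1 <= a%:~R ^+ 2 :> R by rewrite expr_ge1 //; lra.
      move: (a%:~R : R) A8 (a%:~R ^+ 2 : R) => A A8 D D1.
      have : X <= D * X by rewrite ler_peMl // ltW.
      have : 8 * (D * X) <= A * (D * X) by rewrite ler_wpM2r // mulr_ge0 ?ltW //; lra.
      by lra.
    lra.
  rewrite ler_ln ?posrE ?exprn_gt0 //; last by lra.
  by rewrite divr_gt0 // ltr_wpDr // mulr_ge0 ?ler0n // ltW.
have L0 : 0 <= ln a%:~R :> R by rewrite ln_ge0 //; lra.
have GG : (\sum_(1 <= k < N.+1) g k) ^+ 2 <= (3 * ln a%:~R) ^+ 2.
  by rewrite ler_sqr ?nnegrE ?mulr_ge0.
have C320 : 0 <= 32 * C by rewrite mulr_ge0.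
apply: le_trans (ler_wpM2l C320 GG) _.
rewrite le_eqVlt; apply/orP; left; apply/eqP; rewrite /C; field.
by rewrite gt_eqF //; lra.
Qed.

(** Here f and f' stand for |q| and |r| in either order. With k the value of f and v the least
    absolute conjugate, k <= 3v and k v^2 <= 7 y^3 give k^3 <= 63 y^3, hence k <= 4y, and v <= 3
    y^(3/2) / sqrt k. Summing 32 v over k gives 96 y^(3/2) * 2 sqrt (4y) = 384 y^2. *)
Lemma atmost_reduced_edge (y : R) (f f' : triple -> nat) : 0 <= y ->
  (forall k V, 0 <= V -> (0 < k)%N -> atmost R triple (32 * V) (fun t =>
    [/\ f t = k, k%:R <= 3 * `|ev r2 r3 t| & `|ev r2 r3 t| <= V
      /\ f' t = 0%N])) ->
  atmost R triple (384 * y ^+ 2) (fun t =>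
    [/\ (0 < f t)%N, (f t)%:R <= 3 * `|ev r2 r3 t|,
      (f t)%:R * `|ev r2 r3 t| ^+ 2 <= 7 * y ^+ 3
      & f' t = 0%N]).
Proof.
move=> y0 slice; pose g := Num.sqrt y.
have g0 : 0 <= g := sqrtr_ge0 _.
have g2 : g ^+ 2 = y := sqr_sqrtr y0.
pose N := Num.truncn (4 * y).
have NX : N%:R <= 4 * y by rewrite truncn_le; lra.
pose V (k : nat) : R := 3 * g ^+ 3 * (Num.sqrt (k%:R : R))^-1.
have V0 k : 0 <= V k by rewrite !mulr_ge0 ?exprn_ge0 ?invr_ge0 ?sqrtr_ge0.
have h2 k : k \in index_iota 1 N.+1 -> _ := fun kN => slice k (V k) (V0 k)
  (proj1 (andP (etrans (esym (mem_index_iota _ _ _)) kN))).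
have h3 := atmost_bigcup _ _ _ (index_iota 1 N.+1) _ _ h2.
apply: atmost_sub h3.
  move=> t [f0 fV fVy edge].
  have v0 := normr_ge0 (ev r2 r3 t).
  have fy : (f t)%:R <= 4 * y.
    have F0 := ler0n R (f t).
    have : (f t)%:R ^+ 3 <= (4 * y) ^+ 3.
      move: (f t)%:R `|ev r2 r3 t| F0 fV fVy v0 => k v k0 kv kvy v0.
      have : k * (k * k) <= k * (3 * v * (3 * v)).
        by rewrite ler_wpM2l // ler_pM.
      have : 0 <= y ^+ 3 by rewrite exprn_ge0.
      rewrite exprMn; have -> : k ^+ 3 = k * (k * k) by ring.
      by move: kvy; rewrite expr2; lra.
    by rewrite ler_pXn2r ?nnegrE ?mulr_ge0.
  exists (f t); first by rewrite mem_index_iota f0 ltnS truncn_ge_nat ?mulr_ge0.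
  split=> //; split=> //; rewrite /V.
  have F0 : 0 < (f t)%:R :> R by rewrite ltr0n.
  have s0 : 0 < Num.sqrt ((f t)%:R : R) by rewrite sqrtr_gt0.
  rewrite ler_pdivlMr // -ler_sqr ?nnegrE ?mulr_ge0 ?exprn_ge0 ?(ltW s0) //.
  have -> : (`|ev r2 r3 t| * Num.sqrt (f t)%:R) ^+ 2 =
      (f t)%:R * `|ev r2 r3 t| ^+ 2.
    by rewrite exprMn sqr_sqrtr ?ler0n // mulrC.
  apply: le_trans fVy _.
  have -> : (3 * g ^+ 3) ^+ 2 = 9 * (g ^+ 2) ^+ 3 by ring.
  have : 0 <= y ^+ 3 by rewrite exprn_ge0.
  by rewrite g2; lra.
have sN : Num.sqrt (N%:R : R) <= 2 * g.
  rewrite -ler_sqr ?nnegrE ?mulr_ge0 ?sqrtr_ge0 // sqr_sqrtr ?ler0n //.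
  by rewrite exprMn g2; lra.
have -> : \sum_(k <- index_iota 1 N.+1) 32 * V k =
    96 * g ^+ 3 * \sum_(1 <= k < N.+1) (Num.sqrt (k%:R : R))^-1.
  by rewrite big_distrr /=; apply: eq_bigr => k _; rewrite /V; ring.
have := sum_inv_sqrt_le R N; move: (\sum_(_ <= _ < _) _) => S hS.
have g30 : 0 <= 96 * g ^+ 3 by rewrite mulr_ge0 ?exprn_ge0.
have SG : S <= 4 * g by lra.
apply: le_trans (ler_wpM2l g30 SG) _; rewrite -g2.
by rewrite le_eqVlt; apply/orP; left; apply/eqP; ring.
Qed.

Lemma atmost_reduced_edges (y : R) : 0 <= y ->
  atmost R triple (768 * y ^+ 2) (fun t => reduced (a%:~R * y ^+ 3) t /\
    ((absz t.1.2 != 0%N /\ absz t.2 = 0%N)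
     \/ (absz t.1.2 = 0%N /\ absz t.2 != 0%N))).
Proof.
move=> y0; have A0 : 0 < a%:~R :> R.
  by have := conj_ge8 roots; lra.
have slice1 k V : 0 <= V -> (0 < k)%N -> atmost R triple (32 * V) (fun t =>
    [/\ absz t.1.2 = k, k%:R <= 3 * `|ev r2 r3 t|
      & `|ev r2 r3 t| <= V /\ absz t.2 = 0%N]).
  move=> V0 k0; apply: atmost_sub (lexx _) (atmost_slice k 0%N V V0 _).
    by move=> t [tk kV [tV t0]]; split=> //; rewrite mulr_ge0.
  by rewrite addn0.
have slice2 k V : 0 <= V -> (0 < k)%N -> atmost R triple (32 * V) (fun t =>
    [/\ absz t.2 = k, k%:R <= 3 * `|ev r2 r3 t|
      & `|ev r2 r3 t| <= V /\ absz t.1.2 = 0%N]).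
  move=> V0 k0; apply: atmost_sub (lexx _) (atmost_slice 0%N k V V0 _) => //.
  by move=> t [tk kV [tV t0]]; split=> //; rewrite mulr_ge0.
have h := atmostU _ _ _ _ _ _ (atmost_reduced_edge y _ _ y0 slice1)
  (atmost_reduced_edge y _ _ y0 slice2).
apply: atmost_sub h; last by lra.
move=> t [/reduced_slice[qV rV qx rx _] [[q0 r0]|[q0 r0]]]; [left|right].
  split=> //; first by rewrite lt0n.
  rewrite -(ler_pM2l A0); move: qx; lra.
split=> //; first by rewrite lt0n.
rewrite -(ler_pM2l A0); move: rx; lra.
Qed.

Lemma atmost_reduced_int (X : R) : 1 <= X ->
  atmost R triple (4 * X) (fun t => reduced (X ^+ 3) t /\
    (absz t.1.2 = 0%N /\ absz t.2 = 0%N)).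
Proof.
move=> X1; have X0 : 0 <= X by lra.
have h := atmost_image _ _ _ _ _ (fun p : int => (p, 0, 0) : triple)
  (atmost_int_near R 0 X X0).
apply: atmost_sub h; last by lra.
move=> [[p q] r] [/reduced_slice[_ _ _ _ [VX _]] [/= /absz0P q0 /absz0P r0]].
rewrite {}q0 {}r0 in VX *; exists p => //; rewrite addr0.
by move: VX; rewrite ev_int ler_pXn2r ?nnegrE.
Qed.

End reduced_count.
Arguments atmost_reduced_both {R a r1 r2 r3} roots.
Arguments atmost_reduced_edges {R a r1 r2 r3} roots.
Arguments atmost_reduced_int {R a r1 r2 r3} roots.

(** * Counting ideals *)

Lemma natz_mul_dvd (m n : nat) (v : int) : m%:Z = n%:Z * v -> (n %| m)%N.
Proof. by move=> /(congr1 absz); rewrite abszM /= => ->; exact: dvdn_mulr. Qed.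

Section ideal_counts.
Variables (R : realType) (a : int) (r1 r2 r3 : R).
Hypothesis roots : conjugate_roots a%:~R r1 r2 r3.

Let ideal (t : triple) := multiples (adjoin_int r1) (ev r1 r2 t).

(** Moving the least conjugate to the middle may replace the ideal by a conjugate one; recording
    which conjugate of t generates I costs a factor 3 in the count. *)
Definition conjugate_generator (I : set R) (t : triple) : Prop :=
  [\/ I = ideal t, I = ideal (tconj a t) | I = ideal (tconj a (tconj a t))].

Lemma ideal_norm_le (t : triple) (x : R) : t != (0, 0, 0) ->
  (ideal_norm (adjoin_int r1) (ideal t) <= x%:E)%E ->
  `|ev r1 r2 t| * `|ev r2 r3 t| * `|ev r3 r1 t| <= x.
Proof.
move=> t0; rewrite (ideal_norm_triple roots) // lee_fin.
by rewrite natr_absz intr_norm (ev_tnorm roots) !normrM.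
Qed.

Lemma ideal_reduced (I : set R) (x : R) :
  nonzero_principal_ideal (adjoin_int r1) I ->
  (ideal_norm (adjoin_int r1) I <= x%:E)%E ->
  exists2 t, reduced R a r1 r2 r3 x t & conjugate_generator I t.
Proof.
move=> /(nonzero_ideal_triple roots)[t0 t00 ->].
have [t tn0 [<- cmp]] := ideal_comparable_generator roots t0 t00.
move=> /(ideal_norm_le _ _ tn0) tx {t0 t00}.
have [[c12 c13] [c21 c23] [c31 c32]] := cmp.
have tc0 u : u != (0, 0, 0) -> tconj a u != (0, 0, 0).
  apply: contraNneq => e; rewrite -(tconj3 a u) e.
  by rewrite /=; apply/eqP; congr (_, _, _); ring.
have E12 := ev_tconj12 roots; have E23 := ev_tconj23 roots.
have E31 := ev_tconj31 roots.
have [[l1 l3]|[l1 l2]|[l2 l3]] :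
    [\/ `|ev r2 r3 t| <= `|ev r1 r2 t| /\ `|ev r2 r3 t| <= `|ev r3 r1 t|,
        `|ev r3 r1 t| <= `|ev r1 r2 t| /\ `|ev r3 r1 t| <= `|ev r2 r3 t|
      | `|ev r1 r2 t| <= `|ev r2 r3 t| /\ `|ev r1 r2 t| <= `|ev r3 r1 t|].
  move: `|ev r1 r2 t| `|ev r2 r3 t| `|ev r3 r1 t| => v1 v2 v3.
  have [l12|l12] := leP v1 v2; have [l23|l23] := leP v2 v3.
  - by constructor 3; split=> //; exact: le_trans l23.
  - have [l13|l13] := leP v1 v3; first by constructor 3.
    by constructor 2; split; exact: ltW.
  - by constructor 1; split=> //; exact: ltW.
  - by constructor 2; split; [exact: ltW (lt_trans l23 l12)|exact: ltW].
- by exists t; [split|constructor 1].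
- exists (tconj a t); last by constructor 3; rewrite tconj3.
  split; rewrite ?tc0 // ?E12 ?E23 ?E31 //.
  by rewrite mulrC mulrA.
- exists (tconj a (tconj a t)); last by constructor 2; rewrite tconj3.
  split; rewrite ?tc0 // ?E12 ?E23 ?E31 ?E12 ?E23 //.
  by rewrite -mulrA mulrC.
Qed.

Lemma atmost_ideals (n : R) (Q : set triple) (S : set (set R)) :
  atmost R triple n Q ->
  (forall I, S I -> exists2 t, Q t & conjugate_generator I t) ->
  (counting S <= (3 * n)%:E)%E.
Proof.
move=> nQ SQ; apply: atmost_counting.
have h := atmostU _ _ _ _ _ _ (atmost_image _ _ _ _ _ ideal nQ)
  (atmostU _ _ _ _ _ _ (atmost_image _ _ _ _ _ (fun t => ideal (tconj a t)) nQ)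
  (atmost_image _ _ _ _ _ (fun t => ideal (tconj a (tconj a t))) nQ)).
apply: atmost_sub h; last by lra.
move=> I /SQ[t Qt [->|->|->]]; first by left; exists t.
  by right; left; exists t.
by right; right; exists t.
Qed.

Lemma rational_generator (I : set R) (p : int) :
  conjugate_generator I (p, 0, 0) -> I = multiples (adjoin_int r1) p%:~R.
Proof.
by rewrite /conjugate_generator /ideal !ev_int; case=> ->; congr multiples;
  rewrite /ev /=; ring.
Qed.

(** An ideal generated by an integer p lies in |p| O. In the primitive count the list of all small
    integers is thereby replaced by 1 and -1. *)
Lemma primitive_rational_generator (I : set R) (p : int) : p != 0 ->
  primitive_ideal (adjoin_int r1) I -> conjugate_generator I (p, 0, 0) ->
  p = 1 \/ p = -1.
Proof.
move=> p0 primI /rational_generator IE.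
have [p1|p2] := leqP (absz p) 1.
  have : absz p = 1%N by apply/eqP; rewrite eqn_leq p1 lt0n absz_eq0.
  by case: (p) => -[|[|k]] //; [left|right].
exfalso; apply: (primI _ p2) => y; rewrite IE => -[z Oz <-].
exists ((sgz p)%:~R * z).
  move: Oz; rewrite (adjoin_intE roots) => -[u _ <-].
  by exists (tmul a (sgz p, 0, 0) u); rewrite // (ev_tmul12 roots) ev_int.
have -> : p%:~R = (absz p)%:R * (sgz p)%:~R :> R.
  by rewrite mulrC pmulrn -intrM -intEsg.
by rewrite mulrA.
Qed.

Lemma nb_principal_le (X y : R) : 1 <= X -> 0 <= y -> a%:~R * y ^+ 3 = X ^+ 3 ->
  (nb_principal (adjoin_int r1) (X ^+ 3) <=
   (3 * ((32 * 56 * 9) * (ln a%:~R ^+ 2 * X ^+ 3 / a%:~R ^+ 2) + 768 * y ^+ 2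
      + 4 * X))%:E)%E.
Proof.
move=> X1 y0 yX; apply: (atmost_ideals _ (reduced R a r1 r2 r3 (X ^+ 3))).
  have h1 := atmost_reduced_both roots X X1.
  have h2 := atmost_reduced_edges roots y y0.
  have h3 := atmost_reduced_int roots X X1.
  rewrite yX in h2.
  apply: atmost_sub (lexx _) (atmostU _ _ _ _ _ _ (atmostU _ _ _ _ _ _ h1 h2) h3).
  move=> t tx; have [q0|q0] := eqVneq (absz t.1.2) 0%N;
    have [r0|r0] := eqVneq (absz t.2) 0%N.
  - by right.
  - by left; right; split=> //; right.
  - by left; right; split=> //; left.
  - by left; left.
by move=> I [I0 Ix]; exact: ideal_reduced.
Qed.

Lemma nb_primitive_principal_le (X y : R) : 1 <= X -> 0 <= y ->
  a%:~R * y ^+ 3 = X ^+ 3 ->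
  (nb_primitive_principal (adjoin_int r1) (X ^+ 3) <=
   (3 * ((32 * 56 * 9) * (ln a%:~R ^+ 2 * X ^+ 3 / a%:~R ^+ 2) + 768 * y ^+ 2
      + 2))%:E)%E.
Proof.
move=> X1 y0 yX; apply: (atmost_ideals _ (fun t =>
    reduced R a r1 r2 r3 (X ^+ 3) t /\ (absz t.1.2 = 0%N -> absz t.2 = 0%N ->
      t \in [:: (1, 0, 0); (-1, 0, 0) : triple]))).
  have h1 := atmost_reduced_both roots X X1.
  have h2 := atmost_reduced_edges roots y y0.
  have h3 : atmost R triple 2
      (fun t => t \in [:: (1, 0, 0); (-1, 0, 0) : triple]).
    by exists [:: (1, 0, 0); (-1, 0, 0)].
  rewrite yX in h2.
  apply: atmost_sub (lexx _) (atmostU _ _ _ _ _ _ (atmostU _ _ _ _ _ _ h1 h2) h3).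
  move=> t [tx tI]; have [q0|q0] := eqVneq (absz t.1.2) 0%N;
    have [r0|r0] := eqVneq (absz t.2) 0%N.
  - by right; exact: tI.
  - by left; right; split=> //; right.
  - by left; right; split=> //; left.
  - by left; left.
move=> I [I0 primI Ix]; have [t tx It] := ideal_reduced _ _ I0 Ix.
exists t => //; split=> //.
case: t tx It => [[p q] r] [t0 _ _ _ _] It /= /absz0P q0 /absz0P r0.
rewrite {}q0 {}r0 in t0 It *.
have p0 : p != 0 by apply: contraNneq t0 => ->.
by have [->|->] := primitive_rational_generator _ _ p0 primI It;
  rewrite !inE eqxx ?orbT.
Qed.

(** The ideals nO with 1 <= n <= N have norm n^3; equality of two of them makes the integers divide
    each other. *)
Lemma le_nb_principal (N : nat) (x : R) : N%:R ^+ 3 <= x ->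
  (N%:R%:E <= nb_principal (adjoin_int r1) x)%E.
Proof.
move=> Nx; rewrite -[N in N%:R%:E](size_iota 1).
apply: (counting_ge_size R _ _ _ (fun n : nat => ideal (n%:Z, 0, 0))).
- exact: iota_uniq.
- move=> m n _ _ /(multiples_eq roots)[[[[u u'] u''] mE] [[[v v'] v''] nE]].
  have dvd k l w w' w'' : (k%:Z, 0, 0) = tmul a (l%:Z, 0, 0) (w, w', w'') ->
      (l %| k)%N.
    by move=> [kE _ _]; apply: (natz_mul_dvd _ _ w); rewrite kE; ring.
  by apply/eqP; rewrite eqn_dvd (dvd _ _ _ _ _ mE) (dvd _ _ _ _ _ nE).
- move=> n; rewrite mem_iota add1n ltnS => /andP[n0 nN].
  have t0 : (n%:Z, 0, 0) != (0, 0, 0) :> triple.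
    by rewrite !xpair_eqE !eqxx !andbT; case: (n) n0.
  split; first by apply/(nonzero_ideal_triple roots); exists (n%:Z, 0, 0).
  rewrite (ideal_norm_triple roots) // lee_fin.
  apply: le_trans Nx; rewrite natr_absz intr_norm (ev_tnorm roots).
  rewrite !ev_int -expr2 -exprSr normrX -pmulrn normr_nat.
  by rewrite lerXn2r ?nnegrE ?ler0n // ler_nat.
Qed.

Lemma primitive_le_principal (x : R) :
  (nb_primitive_principal (adjoin_int r1) x <= nb_principal (adjoin_int r1) x)%E.
Proof. by apply: subset_counting => I [I0 _ Ix]. Qed.

Lemma one_le_primitive (x : R) : 1 <= x ->
  (1%:E <= nb_primitive_principal (adjoin_int r1) x)%E.
Proof.
move=> x1; apply: (counting_ge_size R _ _ [:: (1, 0, 0) : triple] ideal) => //.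
  by move=> t u; rewrite !inE => /eqP -> /eqP ->.
move=> t; rewrite inE => /eqP ->.
split; first by apply/(nonzero_ideal_triple roots); exists (1, 0, 0).
  by apply: (primitive_triple roots).
rewrite (ideal_norm_triple roots) // lee_fin.
have -> : tnorm a (1, 0, 0) = 1 by rewrite /=; ring.
by [].
Qed.

End ideal_counts.
Arguments le_nb_principal {R a r1 r2 r3} roots.
Arguments nb_primitive_principal_le {R a r1 r2 r3} roots.
Arguments nb_principal_le {R a r1 r2 r3} roots.
Arguments one_le_primitive {R a r1 r2 r3} roots.

(** * The estimates *)

Lemma cbrtK (R : realType) (x : R) : 0 <= x -> (x `^ (1 / 3)) ^+ 3 = x.
Proof.
move=> x0; rewrite -powR_mulrn ?powR_ge0 // -powRrM.
by rewrite (_ : 1 / 3 * 3 = 1) ?powRr1 //; field.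
Qed.

Lemma powR_two_thirds (R : realType) (x : R) :
  x `^ (2 / 3) = (x `^ (1 / 3)) ^+ 2.
Proof.
rewrite -powR_mulrn ?powR_ge0 // -powRrM.
by congr (_ `^ _); field.
Qed.

Lemma truncn_gt_half (R : realType) (x : R) : 1 <= x ->
  x <= 2 * (Num.truncn x)%:R.
Proof.
move=> x1; have := truncnS_gt x; rewrite -natr1.
have : 1 <= (Num.truncn x)%:R :> R by rewrite ler1n truncn_gt0.
lra.
Qed.

Lemma truncn_le_self (R : realType) (x : R) : 0 <= x -> (Num.truncn x)%:R <= x.
Proof. by rewrite truncn_le. Qed.

Lemma log_scale_exists (n : nat) : (8 <= n)%N ->
  exists m, (8 * 512 ^ m <= n < 8 * 512 ^ m.+1)%N.
Proof.
move=> n8; have n0 : (0 < n %/ 8)%N by rewrite divn_gt0.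
exists (trunc_log 512 (n %/ 8)).
have /andP[h1 h2] := trunc_log_bounds (isT : (1 < 512)%N) n0.
by rewrite mulnC -leq_divRL // h1 mulnC -ltn_divLR.
Qed.

(** From ln (h^3) = 6 ln (sqrt h) <= 6 sqrt h. With h^3 = a it handles the values of x below the
    range of the logarithmic family. *)
Lemma ln_sqr_le (R : realType) (h : R) : 1 <= h -> ln (h ^+ 3) ^+ 2 <= 36 * h.
Proof.
move=> h1; have h0 : 0 < h by lra.
have s0 : 0 < Num.sqrt h by rewrite sqrtr_gt0.
have s2 : Num.sqrt h ^+ 2 = h by rewrite sqr_sqrtr // ltW.
have -> : ln (h ^+ 3) = 6 * ln (Num.sqrt h).
  have lnh : ln h = 2 * ln (Num.sqrt h) by rewrite -{1}s2 lnXn // mulr_natl.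
  by rewrite lnXn // lnh -mulr_natl; ring.
have l1 : ln (Num.sqrt h) <= Num.sqrt h by rewrite ltW // ln_sublinear.
have l0 : 0 <= ln (Num.sqrt h).
  by rewrite ln_ge0 // -sqrtr1 ler_wsqrtr.
have : (6 * ln (Num.sqrt h)) ^+ 2 <= (6 * Num.sqrt h) ^+ 2.
  by rewrite ler_sqr ?nnegrE ?mulr_ge0 // ?(ltW s0) // ler_wpM2l.
by rewrite [(6 * Num.sqrt h) ^+ 2]exprMn s2; lra.
Qed.

(** The bound ln 2 <= 1 gives ln 8 <= 3 and ln 512 <= 9, hence ln A <= 3 + 9 (m + 1). So the number
    of scales m + 1 is at least ln a / 12. *)
Lemma ln_le_scale (R : realType) (A : R) (m : nat) : 0 < A ->
  A <= 8 * 512 ^+ m.+1 -> ln A <= 12 * m.+1%:R.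
Proof.
move=> A0 Am.
have l2 : ln 2 <= 1 :> R.
  by have := @le_ln1Dx R 1 _; rewrite (_ : 1 + 1 = 2) //; apply; lra.
have l8 : ln 8 <= 3 :> R.
  have -> : ln 8 = 3 * ln 2 :> R.
    by rewrite mulr_natl -lnXn //; congr ln; ring.
  lra.
have l512 : ln 512 <= 9 :> R.
  have -> : ln 512 = 9 * ln 2 :> R.
    by rewrite mulr_natl -lnXn //; congr ln; ring.
  lra.
have p0 : 0 < 512 :> R by rewrite ltr0n.
have p512 : 0 < 512 ^+ m.+1 :> R by exact: exprn_gt0.
move: (512 : R) p0 p512 l512 Am => c p0 p512 l512 Am.
have : ln A <= ln (8 * c ^+ m.+1).
  by rewrite ler_ln ?posrE ?mulr_gt0.
rewrite lnM ?posrE // lnXn // -[ln c *+ _]mulr_natl.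
have m1 : 1 <= m.+1%:R :> R by rewrite ler1n.
have : m.+1%:R * ln c <= m.+1%:R * 9 :> R by rewrite ler_wpM2l.
lra.
Qed.

Section final_bounds.
Variables (R : realType) (a : int) (r1 r2 r3 : R).
Hypothesis roots : conjugate_roots a%:~R r1 r2 r3.

Lemma sqr_le_primitive (y v : R) : 0 <= y ->
  nb_primitive_principal (adjoin_int r1) (a%:~R * y ^+ 3) = v%:E -> 1 <= v ->
  y ^+ 2 <= 400 * v.
Proof.
move=> y0 nv v1; have [y20|y20] := ltP (y / 20) 1.
  have : y * y <= 20 * 20 by apply: ler_pM => //; lra.
  by rewrite expr2; lra.
(* The divisor 20 is large enough because 16 * 16 * 24 <= 20^3. *)
pose T := Num.truncn (y / 20).
have Ty : T%:R <= y / 20 by apply: truncn_le_self; lra.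
have yT : y / 20 <= 2 * T%:R by exact: truncn_gt_half.
have A8 := conj_ge8 roots.
have Tx : 16 * 16 * 24 * a%:~R * T%:R ^+ 3 <= a%:~R * y ^+ 3.
  have : T%:R ^+ 3 <= (y / 20) ^+ 3 by rewrite lerXn2r ?nnegrE ?ler0n //; lra.
  have -> : (y / 20) ^+ 3 = y ^+ 3 / (20 * 20 * 20) by field.
  move=> h; have -> : 16 * 16 * 24 * a%:~R * T%:R ^+ 3 =
    a%:~R * (16 * 16 * 24 * T%:R ^+ 3) :> R by ring.
  rewrite ler_wpM2l //; first lra.
  have : 0 <= y ^+ 3 by rewrite exprn_ge0.
  by lra.
have := coprime_family_le_counting roots T _ Tx.
rewrite nv lee_fin !natrM.
have : y / 20 * (y / 20) <= 2 * T%:R * (2 * T%:R) by apply: ler_pM => //; lra.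
by rewrite expr2; lra.
Qed.

Lemma log_term_le_primitive (y v : R) : 0 <= y ->
  nb_primitive_principal (adjoin_int r1) (a%:~R * y ^+ 3) = v%:E -> 1 <= v ->
  ln a%:~R ^+ 2 * (a%:~R * y ^+ 3) / a%:~R ^+ 2 <= 144 * (20 * 20 * 10) * v.
Proof.
move=> y0 nv v1; have A8 := conj_ge8 roots.
have [m [ma am]] : exists m, 8 * 512 ^+ m <= a%:~R :> R
    /\ a%:~R <= 8 * 512 ^+ m.+1 :> R.
  have aE : a%:~R = (absz a)%:R :> R.
    by rewrite natr_absz ger0_norm // -(ler0z R); lra.
  have [|m /andP[m1 m2]] := log_scale_exists (absz a).
    by rewrite -(ler_nat R) -aE.
  exists m; rewrite aE -!natrX -!natrM !ler_nat; split=> //.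
  exact: ltnW.
pose h : R := a%:~R `^ (1 / 3).
have h3 : h ^+ 3 = a%:~R by apply: cbrtK; lra.
have h0 : 0 <= h by exact: powR_ge0.
have h1 : 1 <= h.
  rewrite leNgt; apply/negP => h1; have : h ^+ 3 <= 1 by rewrite exprn_ile1 // ltW.
  by rewrite h3; lra.
pose s : R := 8 ^+ m; have s0 : 0 < s by rewrite exprn_gt0.
have s3 : s ^+ 3 = 512 ^+ m by rewrite /s -exprM mulnC exprM; congr (_ ^+ _); ring.
have hs : 2 * s <= h.
  rewrite -(ler_pXn2r (isT : (0 < 3)%N)) ?nnegrE ?mulr_ge0 // ?(ltW s0) //.
  by rewrite exprMn s3 h3; lra.
have lnA := ln_le_scale _ _ _ (_ : 0 < a%:~R) am.
have A0 : 0 < a%:~R :> R by lra.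
have {}lnA := lnA A0.
have L0 : 0 <= ln a%:~R :> R by rewrite ln_ge0 //; lra.
have hn0 : h != 0 by rewrite gt_eqF //; lra.
have sn0 : s != 0 by rewrite gt_eqF.
(* The largest admissible B up to a constant: the norm bound requires 15 * 26 * 15 * a B^3 s^3 <=
   y^3, where a = h^3 and 15 * 26 * 15 <= 20^3. *)
pose b := y / (20 * h * s).
have b0 : 0 <= b by rewrite divr_ge0 // !mulr_ge0 // ltW.
have b3 : (20 * 20 * 20) * (h ^+ 3 * s ^+ 3 * b ^+ 3) = y ^+ 3.
  by rewrite /b; field; rewrite hn0 sn0.
(* For b < 1 there is no box with B >= 1, but then y <= 20 h s <= 10 h^2, and the logarithmic term
   is at most 360 y^2, which [sqr_le_primitive] controls. *)
have [b1|b1] := ltP b 1.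
  have yb : y <= 10 * h ^+ 2.
    have -> : y = 20 * h * s * b by rewrite /b; field; rewrite hn0 sn0.
    have : 20 * h * s * b <= 20 * h * s * 1.
      by rewrite ler_wpM2l ?(ltW b1) // !mulr_ge0 // ltW.
    have : h * (2 * s) <= h * h by rewrite ler_wpM2l.
    by rewrite expr2; lra.
  have -> : ln a%:~R ^+ 2 * (a%:~R * y ^+ 3) / a%:~R ^+ 2 =
      ln (h ^+ 3) ^+ 2 * (y ^+ 2 * (y / h ^+ 3)).
    by rewrite h3; field; lra.
  have yh : y / h ^+ 3 <= 10 / h.
    rewrite ler_pdivrMr ?exprn_gt0 //; last by lra.
    by apply: le_trans yb _; rewrite le_eqVlt; apply/orP; left; apply/eqP; field.
  have : ln (h ^+ 3) ^+ 2 * (y ^+ 2 * (y / h ^+ 3)) <=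
      36 * h * (y ^+ 2 * (10 / h)).
    apply: ler_pM; rewrite ?sqr_ge0 ?ln_sqr_le //.
      by rewrite mulr_ge0 ?sqr_ge0 // divr_ge0 ?exprn_ge0.
    by rewrite ler_wpM2l ?sqr_ge0.
  have -> : 36 * h * (y ^+ 2 * (10 / h)) = 360 * y ^+ 2 by field.
  have := sqr_le_primitive _ _ y0 nv v1.
  by lra.
(* Here b <= 2B loses a factor 8 in b^3; with 144 from the logarithm, 20^3 from b and 16 from the
   size of a box the constant is 144 * 20^3 * 8 / 16 = 144 * 4000. *)
pose B := Num.truncn b.
have Bb : B%:R <= b by exact: truncn_le_self.
have bB : b <= 2 * B%:R by exact: truncn_gt_half.
have Bs : (B ^ 3 * 8 ^ (3 * m))%N%:R = B%:R ^+ 3 * s ^+ 3 :> R.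
  by rewrite natrM !natrX /s -exprM mulnC.
have s30 : 0 < s ^+ 3 by rewrite exprn_gt0.
have B3 : B%:R ^+ 3 <= b ^+ 3 by rewrite lerXn2r ?nnegrE.
have b3B : b ^+ 3 <= 8 * B%:R ^+ 3.
  have : b ^+ 3 <= (2 * B%:R) ^+ 3.
    apply: (lerXn2r 3) => //; rewrite nnegrE //.
  by rewrite exprMn; lra.
have Bx : 15 * 26 * 15 * a%:~R ^+ 2 * (B ^ 3 * 8 ^ (3 * m))%N%:R
    <= a%:~R * y ^+ 3.
  rewrite Bs -b3 h3.
  have : a%:~R ^+ 2 * (B%:R ^+ 3 * s ^+ 3) <= a%:~R ^+ 2 * (b ^+ 3 * s ^+ 3).
    by rewrite ler_wpM2l ?sqr_ge0 // ler_wpM2r // ltW.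
  have : 0 <= a%:~R ^+ 2 * (b ^+ 3 * s ^+ 3).
    apply: mulr_ge0; first exact: sqr_ge0.
    by apply: mulr_ge0; [exact: exprn_ge0|exact: ltW].
  lra.
have := log_family_le_counting roots m B _ ma Bx.
rewrite nv lee_fin natrM natrX natrM Bs => nle.
have -> : ln a%:~R ^+ 2 * (a%:~R * y ^+ 3) / a%:~R ^+ 2 =
    ln a%:~R ^+ 2 * ((20 * 20 * 20) * (s ^+ 3 * b ^+ 3)).
  by rewrite -b3 h3; field; lra.
have lnA2 : ln a%:~R ^+ 2 <= 144 * m.+1%:R ^+ 2 :> R.
  have -> : 144 * m.+1%:R ^+ 2 = (12 * m.+1%:R) ^+ 2 :> R by ring.
  by rewrite lerXn2r ?nnegrE ?mulr_ge0.
have sb : s ^+ 3 * b ^+ 3 <= s ^+ 3 * (8 * B%:R ^+ 3).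
  by rewrite ler_wpM2l // ltW.
have sb0 : 0 <= s ^+ 3 * b ^+ 3 by rewrite mulr_ge0 ?exprn_ge0 // ltW.
have q0 : 0 <= 20 * 20 * 20 * (s ^+ 3 * b ^+ 3) by lra.
have q1 : 20 * 20 * 20 * (s ^+ 3 * b ^+ 3) <=
    20 * 20 * 20 * (s ^+ 3 * (8 * B%:R ^+ 3)) by lra.
apply: le_trans (ler_pM (sqr_ge0 _) q0 lnA2 q1) _.
by lra.
Qed.

End final_bounds.
Arguments log_term_le_primitive {R a r1 r2 r3} roots.
Arguments sqr_le_primitive {R a r1 r2 r3} roots.

Theorem theorem1p1 (R : realType) :
  exists c1 c2 : R, 0 < c1 /\ 0 < c2 /\
  forall (a : int) (rho : R), 8 <= a ->
  is_largest_root (simplest_cubic a) rho ->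
  ring_of_integers (adjoin_rat rho) = adjoin_int rho ->
  forall x : R, 1 <= x ->
  let O := ring_of_integers (adjoin_rat rho) in
  let M : R := ln a%:~R ^+ 2 * x / a%:~R ^+ 2 + (x / a%:~R) `^ (2 / 3) in
  ((c1 * (M + x `^ (1 / 3)))%:E <= nb_principal O x)%E /\
  (nb_principal O x <= (c2 * (M + x `^ (1 / 3)))%:E)%E /\
  ((c1 * (M + 1))%:E <= nb_primitive_principal O x)%E /\
  (nb_primitive_principal O x <= (c2 * (M + 1))%:E)%E.
Proof.
(* K exceeds 144 * 4000 + 400 + 2, the sum of the constants for the logarithmic term, for y^2, and
   for X or 1. *)
have [K [K0 KE]] : exists K : R, 0 < K /\ K = 1000 * 1000.
  by exists (1000 * 1000); split; [lra|reflexivity].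
exists K^-1, (3 * (32 * 56 * 9)); split; first by rewrite invr_gt0.
split; first lra.
move=> a rho a8 rho_root -> x x1 /=.
have A8 : 8 <= a%:~R :> R by move: a8; rewrite -(ler_int R).
have rho_gt := largest_root_gt _ _ _ a8 rho_root.
have roots := conjugate_roots_of_eq _ _ _ A8 rho_gt (largest_root_eq _ _ _ rho_root).
have x0 : 0 <= x by lra.
have A0 : 0 < a%:~R :> R by lra.
set X := x `^ (1 / 3); have X3 : X ^+ 3 = x by exact: cbrtK.
have X0 : 0 <= X := powR_ge0 _ _.
have X1 : 1 <= X.
  rewrite leNgt; apply/negP => X1; have : X ^+ 3 < 1 by rewrite exprn_ilt1.
  by rewrite X3; lra.
rewrite powR_two_thirds; set y := (x / a%:~R) `^ (1 / 3).
have y0 : 0 <= y := powR_ge0 _ _.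
have y3 : a%:~R * y ^+ 3 = x.
  have q0 : 0 <= x / a%:~R by apply: divr_ge0 x0 (ltW A0).
  by rewrite /y (cbrtK _ _ q0) mulrC divfK // gt_eqF.
have yX : a%:~R * y ^+ 3 = X ^+ 3 by rewrite X3.
have up := nb_principal_le roots X y X1 y0 yX.
have upp := nb_primitive_principal_le roots X y X1 y0 yX.
rewrite X3 in up upp.
set W := ln _ ^+ 2 * x / _ in up upp *.
have W0 : 0 <= W.
  apply: divr_ge0; last exact: sqr_ge0.
  by apply: mulr_ge0 x0; exact: sqr_ge0.
have y20 := sqr_ge0 y.
have p1 := one_le_primitive roots x x1.
have pn := primitive_le_principal R rho x.
have TX := truncn_le_self _ _ X0.
have T3 : (Num.truncn X)%:R ^+ 3 <= x.
  by rewrite -X3; apply: (lerXn2r 3); rewrite ?nnegrE ?ler0n.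
have Xn := le_nb_principal roots (Num.truncn X) x T3.
have XT := truncn_gt_half _ _ X1.
(* The upper bound excludes the value +oo and the lower bound -oo, so the counts become real
   numbers. *)
case En : (nb_principal _ x) up pn Xn => [n||] //.
case Ev : (nb_primitive_principal _ x) upp p1 => [v||] //.
rewrite !lee_fin => upp v1 up vn Tn.
have yv : y ^+ 2 <= 400 * v.
  by apply: (sqr_le_primitive roots _ _ y0 _ v1); rewrite y3.
have Wv : W <= 144 * (20 * 20 * 10) * v.
  by have := log_term_le_primitive roots _ _ y0 _ v1; rewrite y3; exact.
rewrite !(mulrC K^-1) !ler_pdivrMr // KE.
move: (y ^+ 2) up upp y20 yv => z up upp y20 yv.
clear -W0 y20 X1 up upp v1 vn Tn XT yv Wv.
split; first by clear up upp; lra.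
split; first by clear -W0 y20 X1 up; lra.
by split; [clear up upp|clear -W0 y20 X1 upp]; lra.
Qed.
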